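(* Let $(E_6)^{\tau\gamma}=\{\alpha\in E_6\mid\tau\gamma\alpha=\alpha\tau\gamma\}$. Then there is an isomorphism of groups $$(E_6)^{\tau\gamma}\cong Sp(4)/\mathbb Z_2,\qquad\mathbb Z_2=\{E,-E\}.$$
   Context: $\mathbb H$ is the field of quaternions with basis $1,e_1,e_2,e_3$; the Cayley algebra is $\mathfrak C=\mathbb H\oplus\mathbb He_4$ with $(m+ae_4)(n+be_4)=(mn-\overline b a)+(a\overline n+bm)e_4$, $\overline{m+ae_4}=\overline m-ae_4$. $\mathfrak J=\{X\in M(3,\mathfrak C)\mid X^*=X\}$ with $X\circ Y=\frac12(XY+YX)$, $\mathrm{tr}(X)$ the sum of diagonal entries, $(X,Y)=\mathrm{tr}(X\circ Y)$, $X\times Y=\frac12(2X\circ Y-\mathrm{tr}(X)Y-\mathrm{tr}(Y)X+(\mathrm{tr}(X)\mathrm{tr}(Y)-(X,Y))E)$, $\det X=\frac13(X,X\times X)$. $\mathfrak J^{\mathbb C}=\{X_1+iX_2\mid X_j\in\mathfrak J\}$ is the complexification with these operations extended complex (multi)linearly, $\tau(X_1+iX_2)=X_1-iX_2$ (a conjugate-linear map), $\langle X,Y\rangle=(\tau X,Y)$. $E_6$ is the group of $\mathbb C$-linear isomorphisms $\alpha$ of $\mathfrak J^{\mathbb C}$ with $\det(\alpha X)=\det X$ and $\langle\alpha X,\alpha Y\rangle=\langle X,Y\rangle$. The involution $\gamma(m+ae_4)=m-ae_4$ of $\mathfrak C$ acts entrywise on $\mathfrak J$ and is extended $\mathbb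 C$-linearly to $\mathfrak J^{\mathbb C}$. $Sp(4)=\{A\in M(4,\mathbb H)\mid A^*A=E\}$, $E$ the unit matrix. *)

(* Defs.v *)
From HB Require Import structures.
From mathcomp Require Import all_boot all_order all_algebra.
From mathcomp Require Import complex.
From mathcomp Require Import boolp reals.
From mathcomp Require Import ring.

Set Implicit Arguments.
Unset Strict Implicit.
Unset Printing Implicit Defensive.

Import Order.TTheory GRing.Theory Num.Theory.

Local Open Scope ring_scope.
Local Open Scope complex_scope.

Section Quaternions.
Variable R : realType.

(* [Quat a b c d] is a + b e1 + c e2 + d e3, with e1 e2 = e3, e2 e3 = e1,
   e3 e1 = e2 and e1 ^ 2 = e2 ^ 2 = e3 ^ 2 = -1. *)
Record quat := Quat { q0 : R; q1 : R; q2 : R; q3 : R }.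

Definition quat_tuple (x : quat) := (q0 x, q1 x, q2 x, q3 x).
Definition tuple_quat (t : R * R * R * R) :=
  Quat t.1.1.1 t.1.1.2 t.1.2 t.2.
Lemma quat_tupleK : cancel quat_tuple tuple_quat.
Proof. by case. Qed.
HB.instance Definition _ := Choice.copy quat (can_type quat_tupleK).

Definition quat_add x y :=
  Quat (q0 x + q0 y) (q1 x + q1 y) (q2 x + q2 y) (q3 x + q3 y).
Definition quat_opp x := Quat (- q0 x) (- q1 x) (- q2 x) (- q3 x).
Definition quat_zero := Quat 0 0 0 0.

Fact quat_addA : associative quat_add.
Proof. by move=> x y z; rewrite /quat_add /= !addrA. Qed.
Fact quat_addC : commutative quat_add.
Proof. by move=> x y; congr Quat; rewrite addrC. Qed.
Fact quat_add0 : left_id quat_zero quat_add.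
Proof. by case=> a b c d; rewrite /quat_add /= !add0r. Qed.
Fact quat_addN : left_inverse quat_zero quat_opp quat_add.
Proof. by case=> a b c d; rewrite /quat_add /= !addNr. Qed.
HB.instance Definition _ :=
  GRing.isZmodule.Build quat quat_addA quat_addC quat_add0 quat_addN.

Definition quat_mul x y := Quat
  (q0 x * q0 y - q1 x * q1 y - q2 x * q2 y - q3 x * q3 y)
  (q0 x * q1 y + q1 x * q0 y + q2 x * q3 y - q3 x * q2 y)
  (q0 x * q2 y - q1 x * q3 y + q2 x * q0 y + q3 x * q1 y)
  (q0 x * q3 y + q1 x * q2 y - q2 x * q1 y + q3 x * q0 y).
Definition quat_one := Quat 1 0 0 0.

Fact quat_mulA : associative quat_mul.
Proof. by move=> x y z; congr Quat => /=; ring. Qed.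
Fact quat_mul1l : left_id quat_one quat_mul.
Proof. by case=> a b c d; congr Quat => /=; ring. Qed.
Fact quat_mul1r : right_id quat_one quat_mul.
Proof. by case=> a b c d; congr Quat => /=; ring. Qed.
Fact quat_mulDl : left_distributive quat_mul quat_add.
Proof. by move=> x y z; congr Quat => /=; ring. Qed.
Fact quat_mulDr : right_distributive quat_mul quat_add.
Proof. by move=> x y z; congr Quat => /=; ring. Qed.
Fact quat_one_neq0 : quat_one != 0.
Proof. by apply/eqP => -[] /eqP; rewrite oner_eq0. Qed.
HB.instance Definition _ := GRing.Zmodule_isNzRing.Build quat
  quat_mulA quat_mul1l quat_mul1r quat_mulDl quat_mulDr quat_one_neq0.

Definition quat_scale (a : R) x :=
  Quat (a * q0 x) (a * q1 x) (a * q2 x) (a * q3 x).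
Fact quat_scaleA a b x :
  quat_scale a (quat_scale b x) = quat_scale (a * b) x.
Proof. by congr Quat => /=; rewrite mulrA. Qed.
Fact quat_scale1 : left_id 1 quat_scale.
Proof. by case=> a b c d; congr Quat => /=; rewrite mul1r. Qed.
Fact quat_scaleDr : right_distributive quat_scale +%R.
Proof. by move=> a x y; congr Quat => /=; rewrite mulrDr. Qed.
Fact quat_scaleDl x : {morph quat_scale^~ x : a b / a + b}.
Proof. by move=> a b; congr Quat => /=; rewrite mulrDl. Qed.
HB.instance Definition _ := GRing.Zmodule_isLmodule.Build R quat
  quat_scaleA quat_scale1 quat_scaleDr quat_scaleDl.

Definition quat_conj x := Quat (q0 x) (- q1 x) (- q2 x) (- q3 x).

Fact q0_sum I r (P : pred I) F :
  q0 (\sum_(i <- r | P i) F i) = \sum_(i <- r | P i) q0 (F i).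
Proof. exact: (big_morph q0 (id1 := 0) (op1 := +%R)). Qed.
Fact q1_sum I r (P : pred I) F :
  q1 (\sum_(i <- r | P i) F i) = \sum_(i <- r | P i) q1 (F i).
Proof. exact: (big_morph q1 (id1 := 0) (op1 := +%R)). Qed.
Fact q2_sum I r (P : pred I) F :
  q2 (\sum_(i <- r | P i) F i) = \sum_(i <- r | P i) q2 (F i).
Proof. exact: (big_morph q2 (id1 := 0) (op1 := +%R)). Qed.
Fact q3_sum I r (P : pred I) F :
  q3 (\sum_(i <- r | P i) F i) = \sum_(i <- r | P i) q3 (F i).
Proof. exact: (big_morph q3 (id1 := 0) (op1 := +%R)). Qed.

Fact quat_conjD : {morph quat_conj : x y / x + y}.
Proof. by move=> x y; congr Quat => /=; rewrite opprD. Qed.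
Fact quat_conj0 : quat_conj 0 = 0.
Proof. by congr Quat => /=; rewrite oppr0. Qed.
Fact quat_conjM x y : quat_conj (x * y) = quat_conj y * quat_conj x.
Proof. by congr Quat => /=; ring. Qed.
Fact quat_conjK : involutive quat_conj.
Proof. by case=> a b c d; rewrite /quat_conj /= !opprK. Qed.
Fact quat_conj1 : quat_conj 1 = 1.
Proof. by congr Quat => /=; rewrite oppr0. Qed.

End Quaternions.

Section Cayley.
Variable R : realType.
Local Notation H := (quat R).

(* [Cayley m a] is m + a e4.  The product is not associative, so it is the
   plain function [cay_mul] and not the multiplication of a ring structure. *)
Record cayley := Cayley { cay_m : H; cay_a : H }.

Definition cay_pair (x : cayley) := (cay_m x, cay_a x).
Definition pair_cay (p : H * H) := Cayley p.1 p.2.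
Lemma cay_pairK : cancel cay_pair pair_cay.
Proof. by case. Qed.
HB.instance Definition _ := Choice.copy cayley (can_type cay_pairK).

Definition cay_add x y := Cayley (cay_m x + cay_m y) (cay_a x + cay_a y).
Definition cay_opp x := Cayley (- cay_m x) (- cay_a x).
Definition cay_zero := Cayley 0 0.

Fact cay_addA : associative cay_add.
Proof. by move=> x y z; rewrite /cay_add /= !addrA. Qed.
Fact cay_addC : commutative cay_add.
Proof. by move=> x y; congr Cayley; rewrite addrC. Qed.
Fact cay_add0 : left_id cay_zero cay_add.
Proof. by case=> m a; rewrite /cay_add /= !add0r. Qed.
Fact cay_addN : left_inverse cay_zero cay_opp cay_add.
Proof. by case=> m a; rewrite /cay_add /= !addNr. Qed.
HB.instance Definition _ :=
  GRing.isZmodule.Build cayley cay_addA cay_addC cay_add0 cay_addN.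

Definition cay_scale (r : R) x := Cayley (r *: cay_m x) (r *: cay_a x).
Fact cay_scaleA r s x : cay_scale r (cay_scale s x) = cay_scale (r * s) x.
Proof. by congr Cayley => /=; rewrite scalerA. Qed.
Fact cay_scale1 : left_id 1 cay_scale.
Proof. by case=> m a; congr Cayley => /=; rewrite scale1r. Qed.
Fact cay_scaleDr : right_distributive cay_scale +%R.
Proof. by move=> r x y; congr Cayley => /=; rewrite scalerDr. Qed.
Fact cay_scaleDl x : {morph cay_scale^~ x : r s / r + s}.
Proof. by move=> r s; congr Cayley => /=; rewrite scalerDl. Qed.
HB.instance Definition _ := GRing.Zmodule_isLmodule.Build R cayley
  cay_scaleA cay_scale1 cay_scaleDr cay_scaleDl.

Definition cay_one := Cayley 1 0.

Definition cay_mul x y := Cayley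
  (cay_m x * cay_m y - quat_conj (cay_a y) * cay_a x)
  (cay_a x * quat_conj (cay_m y) + cay_a y * cay_m x).

Definition cay_conj x := Cayley (quat_conj (cay_m x)) (- cay_a x).

Definition cay_gamma x := Cayley (cay_m x) (- cay_a x).

Fact cay_conjD : {morph cay_conj : x y / x + y}.
Proof. by move=> x y; congr Cayley => /=; rewrite (quat_conjD, opprD). Qed.
Fact cay_conj0 : cay_conj 0 = 0.
Proof. by congr Cayley => /=; rewrite (quat_conj0, oppr0). Qed.
Fact cay_conjN : {morph cay_conj : x / - x}.
Proof.
by move=> x; congr Cayley => //=; congr Quat => //=; rewrite opprK.
Qed.
Fact cay_conj_sum I r (P : pred I) F :
  cay_conj (\sum_(i <- r | P i) F i) = \sum_(i <- r | P i) cay_conj (F i).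
Proof. exact: (big_morph _ cay_conjD cay_conj0). Qed.
Fact cay_conjZ r x : cay_conj (r *: x) = r *: cay_conj x.
Proof.
congr Cayley => /=; last by rewrite scalerN.
by congr Quat => /=; rewrite ?mulrN.
Qed.
Fact cay_conjM x y : cay_conj (cay_mul x y) = cay_mul (cay_conj y) (cay_conj x).
Proof.
by case: x y => [[? ? ? ?] [? ? ? ?]] [[? ? ? ?] [? ? ? ?]];
  congr Cayley; congr Quat => /=; ring.
Qed.
Fact cay_conj1 : cay_conj cay_one = cay_one.
Proof. by congr Cayley => /=; rewrite (quat_conj1, oppr0). Qed.
Fact cay_gamma_conj x : cay_conj (cay_gamma x) = cay_gamma (cay_conj x).
Proof. by []. Qed.

End Cayley.

Section JordanAlgebra.
Variable R : realType.
Local Notation M3 := 'M[cayley R]_3.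

Definition cay_adjmx (X : M3) : M3 := \matrix_(i, j) cay_conj (X j i).

Definition cay_mulmx (X Y : M3) : M3 :=
  \matrix_(i, j) \sum_k cay_mul (X i k) (Y k j).

Definition cay_hermitian : {pred M3} := [pred X | cay_adjmx X == X].

Fact cay_hermitian_zmod : zmod_closed cay_hermitian.
Proof.
split=> [|X Y /eqP hX /eqP hY]; apply/eqP/matrixP=> i j.
  by rewrite !mxE cay_conj0.
by rewrite !mxE cay_conjD cay_conjN -[in RHS]hX -[in RHS]hY !mxE.
Qed.
HB.instance Definition _ :=
  GRing.isZmodClosed.Build M3 cay_hermitian cay_hermitian_zmod.

Record J := MkJ { jmx :> M3; jmxP : jmx \in cay_hermitian }.
HB.instance Definition _ := [isSub for jmx].
HB.instance Definition _ := [Choice of J by <:].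
HB.instance Definition _ := [SubChoice_isSubZmodule of J by <:].

Lemma J_hermE (X : J) i j : cay_conj (X i j) = X j i.
Proof. by have /eqP/matrixP/(_ j i) := jmxP X; rewrite mxE. Qed.

Fact jscale_subproof (r : R) (X : J) :
  map_mx (fun x => r *: x) X \in cay_hermitian.
Proof. by apply/eqP/matrixP=> i j; rewrite !mxE cay_conjZ J_hermE. Qed.
Definition jscale r X := MkJ (jscale_subproof r X).

Fact jscaleA r s X : jscale r (jscale s X) = jscale (r * s) X.
Proof. by apply/val_inj/matrixP=> i j; rewrite !mxE scalerA. Qed.
Fact jscale1 : left_id 1 jscale.
Proof. by move=> X; apply/val_inj/matrixP=> i j; rewrite !mxE scale1r. Qed.
Fact jscaleDr : right_distributive jscale +%R.
Proof. by move=> r X Y; apply/val_inj/matrixP=> i j; rewrite !mxE scalerDr. Qed.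
Fact jscaleDl X : {morph jscale^~ X : r s / r + s}.
Proof. by move=> r s; apply/val_inj/matrixP=> i j; rewrite !mxE scalerDl. Qed.
HB.instance Definition _ := GRing.Zmodule_isLmodule.Build R J
  jscaleA jscale1 jscaleDr jscaleDl.

Fact jordan_subproof (X Y : J) :
  map_mx (fun x => 2^-1 *: x) (cay_mulmx X Y + cay_mulmx Y X)
    \in cay_hermitian.
Proof.
apply/eqP/matrixP=> i j; rewrite !mxE cay_conjZ cay_conjD !cay_conj_sum addrC.
by congr (_ *: (_ + _)); apply: eq_bigr => k _; rewrite cay_conjM !J_hermE.
Qed.
Definition jordan (X Y : J) : J := MkJ (jordan_subproof X Y).

(* A diagonal entry of a Hermitian matrix is a real multiple of the unit of
   the Cayley algebra, so the trace is taken in R ([jtrE]). *)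
Definition jtr (X : J) : R := \sum_i q0 (cay_m (X i i)).

Lemma jtrE (X : J) : \sum_i X i i = jtr X *: cay_one R.
Proof.
have h i : X i i = q0 (cay_m (X i i)) *: cay_one R.
  have := J_hermE X i i; case: (X i i) => [[a b c d] [e f g k]] [] hb hc hd he hf hg hk.
  have z (t : R) : - t = t -> t = 0.
    move=> ht; apply/eqP; have : t *+ 2 == 0 by rewrite mulr2n -{1}ht addNr.
    by rewrite mulrn_eq0.
  congr Cayley; congr Quat => /=; rewrite ?mulr1 ?mulr0 //; exact: z.
by rewrite /jtr scaler_suml; apply: eq_bigr => i _; exact: h.
Qed.

Fact jone_subproof :
  (\matrix_(i, j) (if i == j then cay_one R else 0) : M3) \in cay_hermitian.
Proof.
apply/eqP/matrixP=> i j; rewrite !mxE eq_sym.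
by case: eqP => _; rewrite (cay_conj1, cay_conj0).
Qed.
Definition jone : J := MkJ jone_subproof.

Definition jform (X Y : J) : R := jtr (jordan X Y).

Definition jcross (X Y : J) : J :=
  2^-1 *: (2 *: jordan X Y - jtr X *: Y - jtr Y *: X
              + (jtr X * jtr Y - jform X Y) *: jone).

Fact jgamma_subproof (X : J) : map_mx (@cay_gamma R) X \in cay_hermitian.
Proof.
apply/eqP/matrixP=> i j; rewrite !mxE cay_gamma_conj.
by rewrite J_hermE.
Qed.
Definition jgamma (X : J) : J := MkJ (jgamma_subproof X).

End JordanAlgebra.

Section Complexification.
Variable R : realType.

(* [Cplx x y] is x + i y. *)
Record cplx (V : lmodType R) := Cplx { cre : V; cim : V }.

Section Module.
Variable V : lmodType R.

Definition cplx_pair (x : cplx V) := (cre x, cim x).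
Definition pair_cplx (p : V * V) := Cplx p.1 p.2.
Lemma cplx_pairK : cancel cplx_pair pair_cplx.
Proof. by case. Qed.
HB.instance Definition _ := Choice.copy (cplx V) (can_type cplx_pairK).

Definition cplx_add (x y : cplx V) := Cplx (cre x + cre y) (cim x + cim y).
Definition cplx_opp (x : cplx V) := Cplx (- cre x) (- cim x).
Definition cplx_zero := Cplx (0 : V) 0.

Fact cplx_addA : associative cplx_add.
Proof. by move=> x y z; rewrite /cplx_add /= !addrA. Qed.
Fact cplx_addC : commutative cplx_add.
Proof. by move=> x y; congr Cplx; rewrite addrC. Qed.
Fact cplx_add0 : left_id cplx_zero cplx_add.
Proof. by case=> x y; rewrite /cplx_add /= !add0r. Qed.
Fact cplx_addN : left_inverse cplx_zero cplx_opp cplx_add.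
Proof. by case=> x y; rewrite /cplx_add /= !addNr. Qed.
HB.instance Definition _ :=
  GRing.isZmodule.Build (cplx V) cplx_addA cplx_addC cplx_add0 cplx_addN.

Definition cplx_scale (z : R[i]) (x : cplx V) :=
  Cplx (complex.Re z *: cre x - complex.Im z *: cim x)
       (complex.Re z *: cim x + complex.Im z *: cre x).
Fact cplx_scaleA z w x : cplx_scale z (cplx_scale w x) = cplx_scale (z * w) x.
Proof.
case: z w => [a b] [c d]; congr Cplx => /=.
- rewrite scalerBr scalerDr scalerBl scalerDl !scalerA !opprD.
  by rewrite [X in _ + X = _]addrC addrACA.
- rewrite scalerBr scalerDr scalerBl scalerDl !scalerA.
  by rewrite [X in _ + X = _]addrC addrACA.
Qed.
Fact cplx_scale1 : left_id 1 cplx_scale.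
Proof. by case=> x y; congr Cplx => /=; rewrite scale1r scale0r ?subr0 ?addr0. Qed.
Fact cplx_scaleDr : right_distributive cplx_scale +%R.
Proof.
by move=> z x y; congr Cplx => /=; rewrite !scalerDr ?opprD addrACA.
Qed.
Fact cplx_scaleDl x : {morph cplx_scale^~ x : z w / z + w}.
Proof.
by move=> [a b] [c d]; congr Cplx => /=; rewrite !scalerDl ?opprD addrACA.
Qed.
HB.instance Definition _ := GRing.Zmodule_isLmodule.Build R[i] (cplx V)
  cplx_scaleA cplx_scale1 cplx_scaleDr cplx_scaleDl.

Definition cplx_tau (x : cplx V) : cplx V := Cplx (cre x) (- cim x).

(* The complex bilinear extension of a real-valued bilinear form. *)
Definition cplx_form (b : V -> V -> R) (x y : cplx V) : R[i] :=
  (b (cre x) (cre y) - b (cim x) (cim y)) +i*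
  (b (cre x) (cim y) + b (cim x) (cre y)).

End Module.

(* The complex linear (bilinear) extension of a real linear (bilinear) map. *)
Definition cplx_map (V W : lmodType R) (f : V -> W) (x : cplx V) : cplx W :=
  Cplx (f (cre x)) (f (cim x)).
Definition cplx_map2 (V W : lmodType R) (b : V -> V -> W) (x y : cplx V) :
    cplx W :=
  Cplx (b (cre x) (cre y) - b (cim x) (cim y))
       (b (cre x) (cim y) + b (cim x) (cre y)).

End Complexification.

Section ComplexJordanAlgebra.
Variable R : realType.

Definition JC := cplx (J R).
HB.instance Definition _ := GRing.Lmodule.on JC.

Definition jcform (X Y : JC) : R[i] := cplx_form (@jform R) X Y.
Definition jccross (X Y : JC) : JC := cplx_map2 (@jcross R) X Y.
(* The cubic form 1/3 (X, X x X) on J is extended through the complex bilinear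
   extensions of ( , ) and x. *)
Definition jcdet (X : JC) : R[i] := 3^-1 * jcform X (jccross X X).
Definition jctau (X : JC) : JC := cplx_tau X.
Definition jcherm (X Y : JC) : R[i] := jcform (jctau X) Y.
Definition jcgamma (X : JC) : JC := cplx_map (@jgamma R) X.

End ComplexJordanAlgebra.

Section LinearAutomorphisms.
Variables (K : nzRingType) (V : lmodType K).

Record linaut := LinAut {
  linaut_fun :> V -> V;
  linautP : `[< linear linaut_fun /\ bijective linaut_fun >] }.
HB.instance Definition _ := [isSub for linaut_fun].
HB.instance Definition _ := [Choice of linaut by <:].

Lemma linaut_linear (f : linaut) : linear f.
Proof. by have /asboolP[] := linautP f. Qed.
Lemma linaut_bij (f : linaut) : bijective f.
Proof. by have /asboolP[] := linautP f. Qed.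
Lemma linaut_ext (f g : linaut) : f =1 g -> f = g.
Proof. by move=> fg; apply/val_inj/funext. Qed.

Fact linaut_one_subproof : `[< linear (@id V) /\ bijective (@id V) >].
Proof. by apply/asboolP; split=> //; exists id. Qed.
Definition linaut_one := LinAut linaut_one_subproof.

Fact linaut_mul_subproof (f g : linaut) :
  `[< linear (f \o g) /\ bijective (f \o g) >].
Proof.
apply/asboolP; split; last by apply: bij_comp; exact: linaut_bij.
by move=> a x y /=; rewrite !linaut_linear.
Qed.
Definition linaut_mul (f g : linaut) := LinAut (linaut_mul_subproof f g).

Fact linaut_inv_exists (f : linaut) :
  exists g : V -> V, cancel f g /\ cancel g f.
Proof. by have [g fK gK] := linaut_bij f; exists g. Qed.
Definition linaut_inv_fun (f : linaut) := sval (cid (linaut_inv_exists f)).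
Lemma linaut_invK (f : linaut) : cancel f (linaut_inv_fun f).
Proof. by rewrite /linaut_inv_fun; case: cid => g []. Qed.
Lemma linaut_invKV (f : linaut) : cancel (linaut_inv_fun f) f.
Proof. by rewrite /linaut_inv_fun; case: cid => g []. Qed.

Fact linaut_inv_subproof (f : linaut) :
  `[< linear (linaut_inv_fun f) /\ bijective (linaut_inv_fun f) >].
Proof.
apply/asboolP; split.
  move=> a x y; apply: (can_inj (linaut_invK f)).
  by rewrite linaut_linear !linaut_invKV.
exists f; [exact: linaut_invKV | exact: linaut_invK].
Qed.
Definition linaut_inv (f : linaut) := LinAut (linaut_inv_subproof f).

Fact linaut_mulA : associative linaut_mul.
Proof. by move=> f g h; apply: linaut_ext. Qed.
Fact linaut_mul1l : left_id linaut_one linaut_mul.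
Proof. by move=> f; apply: linaut_ext. Qed.
Fact linaut_mul1r : right_id linaut_one linaut_mul.
Proof. by move=> f; apply: linaut_ext. Qed.
Fact linaut_mulVl : left_inverse linaut_one linaut_inv linaut_mul.
Proof. by move=> f; apply: linaut_ext; exact: linaut_invK. Qed.
Fact linaut_mulVr : right_inverse linaut_one linaut_inv linaut_mul.
Proof. by move=> f; apply: linaut_ext; exact: linaut_invKV. Qed.
HB.instance Definition _ := isGroup.Build linaut
  linaut_mulA linaut_mul1l linaut_mul1r linaut_mulVl linaut_mulVr.

Lemma linaut_mulE (f g : linaut) x : (f * g)%g x = f (g x).
Proof. by []. Qed.
Lemma linaut_oneE x : (1%g : linaut) x = x.
Proof. by []. Qed.

End LinearAutomorphisms.

Section E6.
Variable R : realType.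
Local Notation JC := (JC R).

Definition isE6 : {pred linaut JC} := fun f : linaut JC =>
  `[< (forall X, jcdet (f X) = jcdet X) /\
      (forall X Y, jcherm (f X) (f Y) = jcherm X Y) >].

Fact isE6_group : group_closed isE6.
Proof.
split; first exact/asboolP.
move=> f g /asboolP[fd fh] /asboolP[gd gh].
have gK x : g (g^-1%g x) = x by rewrite -linaut_mulE mulgV linaut_oneE.
by apply/asboolP; split=> [X|X Y];
  rewrite ?linaut_mulE ?fd ?fh -1?gd -1?gh !gK.
Qed.

Record E6 := MkE6 { E6_val :> linaut JC; E6P : E6_val \in isE6 }.
HB.instance Definition _ := [isSub for E6_val].
HB.instance Definition _ := [Choice of E6 by <:].
HB.instance Definition _ := SubChoice_isSubGroup.Build _ _ E6 isE6_group.

Definition commutes_taugamma : {pred E6} := fun f : E6 =>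
  `[< forall X : JC, jctau (jcgamma (f X)) = f (jctau (jcgamma X)) >].

Fact commutes_taugamma_group : group_closed commutes_taugamma.
Proof.
split; first exact/asboolP.
move=> f g /asboolP hf /asboolP hg; apply/asboolP => X.
have gK x : g ((g^-1%g : E6) x) = x.
  by rewrite -linaut_mulE -[(_ * _)%g]/(val (g * g^-1)%g) mulgV.
have Kg x : (g^-1%g : E6) (g x) = x.
  by rewrite -linaut_mulE -[(_ * _)%g]/(val (g^-1 * g)%g) mulVg.
have E x : ((f / g)%g : E6) x = f ((g^-1%g : E6) x) by [].
by rewrite !E hf -[in RHS](gK X) hg Kg.
Qed.

Record E6_taugamma := MkE6_taugamma {
  E6_taugamma_val :> E6;
  E6_taugammaP : E6_taugamma_val \in commutes_taugamma }.
HB.instance Definition _ := [isSub for E6_taugamma_val].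
HB.instance Definition _ := [Choice of E6_taugamma by <:].
HB.instance Definition _ :=
  SubChoice_isSubGroup.Build _ _ E6_taugamma commutes_taugamma_group.

End E6.

Section Sp4.
Variable R : realType.
Local Notation H := (quat R).

Definition quat_adjmx n (A : 'M[H]_n) : 'M[H]_n :=
  \matrix_(i, j) quat_conj (A j i).

Definition isSp4 : {pred 'M[H]_4} := [pred A | quat_adjmx A *m A == 1%:M].

Section LeftInverse.
Variable n : nat.
Implicit Types A B : 'M[H]_n.

(* With A = P + Q e2 for complex matrices P and Q, the matrix
   [[P, Q], [- Q', P']], with ' the entrywise complex conjugation, defines an
   injective ring homomorphism into complex matrices. *)
Let cP A : 'M[R[i]]_n := \matrix_(i, j) (q0 (A i j) +i* q1 (A i j)).
Let cQ A : 'M[R[i]]_n := \matrix_(i, j) (q2 (A i j) +i* q3 (A i j)).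
Let cP' A : 'M[R[i]]_n := \matrix_(i, j) (q0 (A i j) +i* - q1 (A i j)).
Let cQ' A : 'M[R[i]]_n := \matrix_(i, j) (- q2 (A i j) +i* q3 (A i j)).
Let rep A := block_mx (cP A) (cQ A) (cQ' A) (cP' A).

Let Re_sum I r (P : pred I) (F : I -> R[i]) :
  complex.Re (\sum_(i <- r | P i) F i) = \sum_(i <- r | P i) complex.Re (F i).
Proof.
by apply: (big_morph _ (id1 := 0) (op1 := +%R)) => // -[? ?] [? ?].
Qed.
Let Im_sum I r (P : pred I) (F : I -> R[i]) :
  complex.Im (\sum_(i <- r | P i) F i) = \sum_(i <- r | P i) complex.Im (F i).
Proof.
by apply: (big_morph _ (id1 := 0) (op1 := +%R)) => // -[? ?] [? ?].
Qed.

Let complexP (x y : R[i]) :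
  complex.Re x = complex.Re y -> complex.Im x = complex.Im y -> x = y.
Proof. by case: x y => [a b] [c d] /= -> ->. Qed.

Let repM A B : rep (A *m B) = rep A *m rep B.
Proof.
rewrite /rep mulmx_block; congr block_mx; apply/matrixP=> i j;
  rewrite !mxE ?q0_sum ?q1_sum ?q2_sum ?q3_sum -big_split /=;
  apply: complexP; rewrite /= ?Re_sum ?Im_sum -?sumrN;
  by apply: eq_bigr => k _; rewrite !mxE /=; ring.
Qed.

Let rep1 : rep 1%:M = 1%:M.
Proof.
rewrite scalar_mx_block; congr block_mx; apply/matrixP=> i j;
  by rewrite !mxE; case: (i == j) => //; apply: complexP; rewrite /= ?oppr0.
Qed.

Let rep_inj : injective rep.
Proof.
move=> A B /eq_block_mx[/matrixP hP /matrixP hQ _ _]; apply/matrixP=> i j.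
have := hP i j; have := hQ i j; rewrite !mxE.
by case: (A i j) (B i j) => [? ? ? ?] [? ? ? ?] [/= -> ->] [-> ->].
Qed.

Lemma quat_mulmx1C A B : A *m B = 1%:M -> B *m A = 1%:M.
Proof.
move=> AB; apply: rep_inj; rewrite repM rep1; apply: mulmx1C.
by rewrite -repM AB rep1.
Qed.

End LeftInverse.

Lemma quat_adjmxM n (A B : 'M[H]_n) :
  quat_adjmx (A *m B) = quat_adjmx B *m quat_adjmx A.
Proof.
apply/matrixP=> i j; rewrite !mxE (big_morph _ (@quat_conjD R) (@quat_conj0 R)).
by apply: eq_bigr => k _; rewrite !mxE quat_conjM.
Qed.
Lemma quat_adjmxK n : involutive (@quat_adjmx n).
Proof. by move=> A; apply/matrixP=> i j; rewrite !mxE quat_conjK. Qed.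

Record Sp4 := MkSp4 { Sp4_mx :> 'M[H]_4; Sp4P : Sp4_mx \in isSp4 }.
HB.instance Definition _ := [isSub for Sp4_mx].
HB.instance Definition _ := [Choice of Sp4 by <:].

Fact Sp4_one_subproof : 1%:M \in isSp4.
Proof.
apply/eqP; rewrite mulmx1; apply/matrixP=> i j; rewrite !mxE eq_sym.
by case: eqP => _; rewrite (quat_conj1, quat_conj0).
Qed.
Definition Sp4_one := MkSp4 Sp4_one_subproof.

Fact Sp4_mul_subproof (A B : Sp4) : A *m B \in isSp4.
Proof.
have /eqP hA := Sp4P A; have /eqP hB := Sp4P B.
by apply/eqP; rewrite quat_adjmxM mulmxA -(mulmxA _ _ A) hA mulmx1.
Qed.
Definition Sp4_mul (A B : Sp4) := MkSp4 (Sp4_mul_subproof A B).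

Fact Sp4_inv_subproof (A : Sp4) : quat_adjmx A \in isSp4.
Proof. by apply/eqP; rewrite quat_adjmxK; apply/quat_mulmx1C/eqP/Sp4P. Qed.
Definition Sp4_inv (A : Sp4) := MkSp4 (Sp4_inv_subproof A).

Fact Sp4_mulA : associative Sp4_mul.
Proof. by move=> A B C; apply/val_inj; rewrite /= mulmxA. Qed.
Fact Sp4_mul1l : left_id Sp4_one Sp4_mul.
Proof. by move=> A; apply/val_inj; rewrite /= mul1mx. Qed.
Fact Sp4_mul1r : right_id Sp4_one Sp4_mul.
Proof. by move=> A; apply/val_inj; rewrite /= mulmx1. Qed.
Fact Sp4_mulVl : left_inverse Sp4_one Sp4_inv Sp4_mul.
Proof. by move=> A; apply/val_inj/eqP/Sp4P. Qed.
Fact Sp4_mulVr : right_inverse Sp4_one Sp4_inv Sp4_mul.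
Proof. by move=> A; apply/val_inj/quat_mulmx1C/eqP/Sp4P. Qed.
HB.instance Definition _ := isGroup.Build Sp4
  Sp4_mulA Sp4_mul1l Sp4_mul1r Sp4_mulVl Sp4_mulVr.

End Sp4.

Section QuotientGroup.
Local Open Scope group_scope.
Local Open Scope quotient_scope.

Record normalSubgroup (G : groupType) := NormalSubgroup {
  nsub_pred :> {pred G};
  nsub_group : group_closed nsub_pred;
  nsub_norm : forall x y : G, x \in nsub_pred -> x ^ y \in nsub_pred }.

Variables (G : groupType) (N : normalSubgroup G).

(* x and y are in the same left coset of N. *)
Definition coset_rel (x y : G) : bool := x^-1 * y \in (N : {pred G}).

Let N1 : 1 \in (N : {pred G}).
Proof. by have [] := nsub_group N. Qed.
Let NF x y : x \in (N : {pred G}) -> y \in (N : {pred G}) ->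
  x / y \in (N : {pred G}).
Proof. by have [_] := nsub_group N; exact. Qed.
Let NV x : x \in (N : {pred G}) -> x^-1 \in (N : {pred G}).
Proof. by move=> Nx; rewrite -[x^-1]mul1g; exact: NF. Qed.
Let NM x y : x \in (N : {pred G}) -> y \in (N : {pred G}) ->
  x * y \in (N : {pred G}).
Proof. by move=> Nx Ny; rewrite -[y]invgK; apply/NF/NV. Qed.

Fact coset_rel_refl : reflexive coset_rel.
Proof. by move=> x; rewrite /coset_rel mulVg. Qed.
Fact coset_rel_sym : symmetric coset_rel.
Proof.
by move=> x y; apply/idP/idP => /NV; rewrite /coset_rel invgM invgK.
Qed.
Fact coset_rel_trans : transitive coset_rel.
Proof.
by move=> y x z xy /(NM xy); rewrite /coset_rel mulgA -(mulgA _ y) mulgV mulg1.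
Qed.
Canonical coset_equiv :=
  EquivRel coset_rel coset_rel_refl coset_rel_sym coset_rel_trans.

Definition quotient_group := {eq_quot coset_equiv}.
HB.instance Definition _ := Choice.on quotient_group.
HB.instance Definition _ := EqQuotient.on quotient_group.

Lemma quotient_groupP (x y : G) :
  reflect (\pi_quotient_group x = \pi_quotient_group y)
          (x^-1 * y \in (N : {pred G})).
Proof. by apply: (iffP idP) => [h|/eqquotP//]; apply/eqquotP. Qed.

(* The operations are computed on chosen representatives; independence of the
   choice is [pi_quotient_mul] and [pi_quotient_inv]. *)
Definition quotient_mul (a b : quotient_group) : quotient_group :=
  \pi_quotient_group (repr a * repr b).
Definition quotient_one : quotient_group := \pi_quotient_group 1.
Definition quotient_inv (a : quotient_group) : quotient_group :=
  \pi_quotient_group (repr a)^-1.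

Let repr_pi (x : G) : x^-1 * repr (\pi_quotient_group x) \in (N : {pred G}).
Proof. by apply/quotient_groupP; rewrite reprK. Qed.

Lemma pi_quotient_mul (x y : G) :
  \pi_quotient_group (x * y) =
  quotient_mul (\pi_quotient_group x) (\pi_quotient_group y).
Proof.
apply/quotient_groupP; rewrite invgM -mulgA.
set x' := repr _; set y' := repr _.
have -> : y^-1 * (x^-1 * (x' * y')) = (x^-1 * x') ^ y * (y^-1 * y').
  by rewrite /conjg !mulgA; congr (_ * _); rewrite -[RHS]mulgA mulgV mulg1.
by apply: NM; [apply: nsub_norm|]; apply: repr_pi.
Qed.

Lemma pi_quotient_inv (x : G) :
  \pi_quotient_group x^-1 = quotient_inv (\pi_quotient_group x).
Proof.
apply/quotient_groupP; rewrite invgK; set x' := repr _.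
have -> : x * x'^-1 = ((x^-1 * x')^-1) ^ x^-1.
  by rewrite /conjg !invgM !invgK !mulgA mulgK.
by apply/nsub_norm/NV/repr_pi.
Qed.

Fact quotient_mulA : associative quotient_mul.
Proof.
move=> a b c; rewrite -[a]reprK -[b]reprK -[c]reprK.
rewrite -(pi_quotient_mul (repr b)) -(pi_quotient_mul (repr a) (repr b)).
by rewrite -!(pi_quotient_mul (repr a)) -(pi_quotient_mul (_ * _)) mulgA.
Qed.
Fact quotient_mul1l : left_id quotient_one quotient_mul.
Proof. by move=> a; rewrite -[a]reprK -pi_quotient_mul mul1g. Qed.
Fact quotient_mul1r : right_id quotient_one quotient_mul.
Proof. by move=> a; rewrite -[a]reprK -pi_quotient_mul mulg1. Qed.
Fact quotient_mulVl : left_inverse quotient_one quotient_inv quotient_mul.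
Proof.
by move=> a; rewrite -[a]reprK -pi_quotient_inv -pi_quotient_mul mulVg.
Qed.
Fact quotient_mulVr : right_inverse quotient_one quotient_inv quotient_mul.
Proof.
by move=> a; rewrite -[a]reprK -pi_quotient_inv -pi_quotient_mul mulgV.
Qed.
HB.instance Definition _ := isGroup.Build quotient_group
  quotient_mulA quotient_mul1l quotient_mul1r quotient_mulVl quotient_mulVr.

End QuotientGroup.

Section Sp4Center.
Variable R : realType.

Definition isZ2 : {pred Sp4 R} := fun A : Sp4 R =>
  ((A : 'M[quat R]_4) == 1%:M) || ((A : 'M[quat R]_4) == - 1%:M).

Fact isZ2_group : group_closed isZ2.
Proof.
have adj1 : quat_adjmx (1%:M : 'M[quat R]_4) = 1%:M.
  by have /eqP := Sp4_one_subproof R; rewrite mulmx1.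
have adjN1 : quat_adjmx (- 1%:M : 'M[quat R]_4) = - 1%:M.
  by rewrite -[in RHS]adj1; apply/matrixP => i j; rewrite !mxE; congr Quat.
split; first by rewrite unfold_in eqxx.
move=> A B; rewrite !unfold_in => hA hB.
have -> : ((A / B)%g : 'M_4) = (A : 'M_4) *m quat_adjmx B by [].
by case/orP: hA => /eqP ->; case/orP: hB => /eqP ->;
  rewrite ?adj1 ?adjN1 ?mulNmx ?mul1mx ?opprK eqxx ?orbT.
Qed.

Fact isZ2_norm (A B : Sp4 R) : A \in isZ2 -> (A ^ B)%g \in isZ2.
Proof.
rewrite !unfold_in => hA.
have -> : ((A ^ B)%g : 'M_4) = quat_adjmx B *m (A *m B) by [].
have /eqP hB := Sp4P B.
by case/orP: hA => /eqP ->; rewrite ?mulNmx ?mulmxN mul1mx hB eqxx ?orbT.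
Qed.

Definition Z2 := NormalSubgroup isZ2_group isZ2_norm.

End Sp4Center.

Definition group_isomorphic (G H : groupType) : Prop :=
  exists f : G -> H, bijective f /\ {morph f : x y / (x * y)%g}.

(* Main.v *)
Require Import Defs.
From mathcomp Require Import all_boot all_order all_algebra.
From mathcomp Require Import complex boolp reals ring lra.

Set Implicit Arguments.
Unset Strict Implicit.
Unset Printing Implicit Defensive.

Import Order.TTheory GRing.Theory Num.Theory.

Local Open Scope ring_scope.
Local Open Scope complex_scope.

(** Let V be the real subspace of J^C fixed by the conjugate-linear involution
  tau gamma, so that J^C = V + iV.  Its elements are the M + i a e4 with
  M in J(3, H) and a in H^3, and
<<
     M + i a e4  |-->  ( t/2      a    )
                       (  a^*  M - t/2 ),     t = tr M,
>>
  identifies V with the space of traceless Hermitian 4 x 4 quaternionic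
  matrices ([to_herm], with inverse [of_herm]).  The point of the construction
  is that, on V, the determinant becomes 1/3 Re tr B^3 and the Hermitian form
  becomes Re tr (B C) ([jcdet_real_point], [jcherm_real_point]).

  Hence for A in Sp(4) the map B |-> A B A^* on V, extended complex linearly
  to J^C, lies in E6 and commutes with tau gamma ([herm_act]).  Determinant and
  Hermitian form of J^C are recovered from their values on V by
  [jcdet_imaginary] and [jcherm_imaginary].

  Conversely an element of E6 that commutes with tau gamma preserves V.  When
  it is extended to J(4, H) by fixing the unit matrix, it preserves Re tr B,
  Re tr B^2 and Re tr B^3; by polarization and nondegeneracy of the trace form
  it preserves the Jordan product ([jordan_endo_of_traces]).  Such a map is
  B |-> A B A^* for some unitary A ([jordan_endo_inner]): the images of the
  diagonal idempotents are orthogonal rank one projections, which provide the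
  columns of A up to scalars; once these are normalized, what remains is one
  ring endomorphism of H acting on every off-diagonal entry, and it is inner
  ([quat_inner]).

  So A |-> (B |-> A B A^* ) is onto.  Its kernel consists of the unitary
  matrices that commute with all Hermitian matrices, which are real scalars of
  square one, that is E and - E ([Sp4_act_ker]); [first_isomorphism]
  concludes. *)

(** * Quaternions *)

Section Quaternions.
Variable R : realType.
Local Notation H := (quat R).
Implicit Types (r : R) (x y p c : H).

Lemma quatP x y :
  q0 x = q0 y -> q1 x = q1 y -> q2 x = q2 y -> q3 x = q3 y -> x = y.
Proof. by case: x y => [? ? ? ?] [? ? ? ?] /= -> -> -> ->. Qed.

Definition qreal r : H := Quat r 0 0 0.

Lemma qrealC r x : x * qreal r = qreal r * x.
Proof. by apply: quatP => /=; ring. Qed.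

Lemma qreal_conj r : quat_conj (qreal r) = qreal r.
Proof. by apply: quatP => /=; rewrite ?oppr0. Qed.

Lemma qreal1 : qreal 1 = 1. Proof. by []. Qed.

Lemma qrealM r s : qreal (r * s) = qreal r * qreal s.
Proof. by apply: quatP => /=; ring. Qed.

Lemma quat_real_of_conj x : quat_conj x = x -> x = qreal (q0 x).
Proof.
by case: x => a b c d [hb hc hd]; apply: quatP => //=; lra.
Qed.

Definition qnorm x : R := q0 x ^+ 2 + q1 x ^+ 2 + q2 x ^+ 2 + q3 x ^+ 2.

Lemma qnorm_ge0 x : 0 <= qnorm x.
Proof. by rewrite /qnorm !addr_ge0 ?sqr_ge0. Qed.

Lemma qnorm_eq0 x : qnorm x = 0 -> x = 0.
Proof.
move=> x0; have [h0 h1 h2 h3] := And4 (sqr_ge0 (q0 x)) (sqr_ge0 (q1 x))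
  (sqr_ge0 (q2 x)) (sqr_ge0 (q3 x)).
move: x0; rewrite /qnorm => x0.
by apply: quatP; apply/eqP; rewrite -sqrf_eq0; apply/eqP; lra.
Qed.

Lemma mul_quat_conj x : x * quat_conj x = qreal (qnorm x).
Proof. by apply: quatP => /=; rewrite /qnorm; ring. Qed.

Lemma mul_conj_quat x : quat_conj x * x = qreal (qnorm x).
Proof. by apply: quatP => /=; rewrite /qnorm; ring. Qed.

Definition qe1 : H := Quat 0 1 0 0.
Definition qe2 : H := Quat 0 0 1 0.
Definition qe3 : H := Quat 0 0 0 1.

Lemma quat_basis x :
  x = qreal (q0 x) + qreal (q1 x) * qe1 + qreal (q2 x) * qe2
    + qreal (q3 x) * qe3.
Proof. by apply: quatP => /=; ring. Qed.

Lemma quat_central x :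
  (forall y, x * y = y * x) -> x = qreal (q0 x).
Proof.
case: x => a b c d h; have := h qe1; have := h qe2 => -[] + + + + [].
by rewrite /= => *; apply: quatP => //=; lra.
Qed.

(** Skolem-Noether for H.  The operator w below turns any c into an
  intertwiner of phi and the identity, and it cannot vanish identically because
  its trace is 4: the trace of c |-> f c e is 4 Re f Re e, and Re e = 0 for the
  three imaginary units. *)
Theorem quat_inner (phi : H -> H) :
    phi 1 = 1 -> {morph phi : x y / x + y} -> {morph phi : x y / x * y} ->
    (forall r x, phi (qreal r * x) = qreal r * phi x) ->
  exists2 p, quat_conj p * p = 1 & forall x, phi x = p * x * quat_conj p.
Proof.
move=> phi1 phiD phiM phiZ.
have phiN1 : phi (- 1) = - 1.
  have -> : - 1 = qreal (-1) * 1 :> H by apply: quatP => /=; ring.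
  by rewrite phiZ phi1.
have phiN x : phi (- x) = - phi x by rewrite -mulN1r phiM phiN1 mulN1r.
pose w c := c - phi qe1 * c * qe1 - phi qe2 * c * qe2 - phi qe3 * c * qe3.
have trw : q0 (w 1) + q0 (quat_conj qe1 * w qe1) + q0 (quat_conj qe2 * w qe2)
    + q0 (quat_conj qe3 * w qe3) = 4 by rewrite /=; ring.
have [c wc0] : exists c, w c != 0.
  apply: contrapT => w0; have {}w0 c : w c = 0.
    by apply/eqP; apply: contrapT => /negP wc; apply: w0; exists c.
  by move: trw; rewrite !w0 !mulr0 /=; lra.
have comm e : e \in [:: qe1; qe2; qe3] -> phi e * w c = w c * e.
  have e11 : qe1 * qe1 = - 1 by apply: quatP => /=; ring.
  have e22 : qe2 * qe2 = - 1 by apply: quatP => /=; ring.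
  have e33 : qe3 * qe3 = - 1 by apply: quatP => /=; ring.
  have e12 : qe1 * qe2 = qe3 by apply: quatP => /=; ring.
  have e23 : qe2 * qe3 = qe1 by apply: quatP => /=; ring.
  have e31 : qe3 * qe1 = qe2 by apply: quatP => /=; ring.
  have e21 : qe2 * qe1 = - qe3 by apply: quatP => /=; ring.
  have e32 : qe3 * qe2 = - qe1 by apply: quatP => /=; ring.
  have e13 : qe1 * qe3 = - qe2 by apply: quatP => /=; ring.
  have ee := (e11, e22, e33, e12, e23, e31, e21, e32, e13).
  rewrite !inE => he; rewrite /w !mulrBr !mulrBl !mulrA -!phiM.
  rewrite -!(mulrA (phi _ * c)).
  case/or3P: he => /eqP ->; rewrite !ee !phiN phi1 !mulN1r !mulNr !mulrN1 !mulrN;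
  by apply: quatP; rewrite [LHS]/= [RHS]/=; ring.
move: (w c) wc0 comm => u u0 comm {w trw c}.
have commx x : phi x * u = u * x.
  rewrite (quat_basis x); move: (q0 x) (q1 x) (q2 x) (q3 x) => a b d e.
  rewrite !phiD !mulrDr !mulrDl.
  have h r : phi (qreal r) = qreal r by rewrite -[qreal r]mulr1 phiZ phi1.
  rewrite !phiZ !h -!mulrA !comm ?inE ?eqxx ?orbT // !mulrA.
  by rewrite !(qrealC _ u).
have N0 : 0 < qnorm u.
  rewrite lt_neqAle qnorm_ge0 andbT eq_sym.
  by apply: contra_neq u0; exact: qnorm_eq0.
pose s := (Num.sqrt (qnorm u))^-1.
have ss : s * s * qnorm u = 1.
  rewrite -expr2 /s exprVn sqr_sqrtr ?qnorm_ge0 // mulVf //.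
  by rewrite gt_eqF.
(* A nonzero intertwiner is invertible; dividing by its norm makes it a unit. *)
exists (qreal s * u).
  rewrite quat_conjM qreal_conj mulrA -(mulrA (quat_conj _)) -qrealM.
  by rewrite qrealC -mulrA mul_conj_quat -qrealM ss.
move=> x; rewrite -(mulrA (qreal s)) -commx quat_conjM qreal_conj.
rewrite !mulrA -[_ * u * _]mulrA mul_quat_conj -[_ * _ * qreal s]mulrA -qrealM.
have ssN : qnorm u * s * s = 1 by rewrite -ss; ring.
by rewrite qrealC mulrA -qrealM ssN mul1r.
Qed.

End Quaternions.

(** * Hermitian quaternionic matrices *)

Section QuaternionicMatrices.
Variables (R : realType) (n : nat).
Local Notation H := (quat R).
Local Notation M := 'M[H]_n.
Implicit Types (r : R) (x y : H) (X Y Z A B : M) (i j k l : 'I_n).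

Lemma quat_adjmxD X Y : quat_adjmx (X + Y) = quat_adjmx X + quat_adjmx Y.
Proof. by apply/matrixP=> i j; rewrite !mxE quat_conjD. Qed.

Lemma quat_adjmx0 : quat_adjmx (0 : M) = 0.
Proof. by apply/matrixP=> i j; rewrite !mxE quat_conj0. Qed.

Lemma quat_adjmxN X : quat_adjmx (- X) = - quat_adjmx X.
Proof. by apply/eqP; rewrite -addr_eq0 -quat_adjmxD addNr quat_adjmx0. Qed.

Lemma quat_adjmx_sum (I : finType) (P : pred I) (F : I -> M) :
  quat_adjmx (\sum_(i | P i) F i) = \sum_(i | P i) quat_adjmx (F i).
Proof. exact: (big_morph _ quat_adjmxD quat_adjmx0). Qed.

Lemma quat_adjmx1 : quat_adjmx (1%:M : M) = 1%:M.
Proof.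
apply/matrixP=> i j; rewrite !mxE eq_sym.
by case: eqP => _; rewrite (quat_conj1, quat_conj0).
Qed.

Lemma quat_adjmx_real r X : quat_adjmx (qreal r *: X) = qreal r *: quat_adjmx X.
Proof. by apply/matrixP=> i j; rewrite !mxE quat_conjM qreal_conj qrealC. Qed.

Lemma mulmx_realr r X Y : X *m (qreal r *: Y) = qreal r *: (X *m Y).
Proof.
apply/matrixP=> i j; rewrite !mxE mulr_sumr; apply: eq_bigr => k _.
by rewrite !mxE !mulrA qrealC.
Qed.

Definition qherm X : Prop := quat_adjmx X = X.

Lemma qhermE X i j : qherm X -> quat_conj (X i j) = X j i.
Proof. by move=> /matrixP/(_ j i); rewrite mxE. Qed.

Lemma qhermD X Y : qherm X -> qherm Y -> qherm (X + Y).
Proof. by rewrite /qherm quat_adjmxD => -> ->. Qed.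

Lemma qhermN X : qherm X -> qherm (- X).
Proof. by rewrite /qherm quat_adjmxN => ->. Qed.

Lemma qhermB X Y : qherm X -> qherm Y -> qherm (X - Y).
Proof. by move=> hX hY; apply/qhermD/qhermN. Qed.

Lemma qherm1 : qherm 1%:M. Proof. exact: quat_adjmx1. Qed.

Lemma qhermZ r X : qherm X -> qherm (qreal r *: X).
Proof. by rewrite /qherm quat_adjmx_real => ->. Qed.

Lemma qherm_congr A X : qherm X -> qherm (A *m X *m quat_adjmx A).
Proof.
by move=> hX; rewrite /qherm !quat_adjmxM quat_adjmxK hX mulmxA.
Qed.

(** Twice the Jordan product, which keeps the formulas free of halves. *)
Definition jprod X Y := X *m Y + Y *m X.

Lemma jprod_herm X Y : qherm X -> qherm Y -> qherm (jprod X Y).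
Proof.
by move=> hX hY; rewrite /qherm quat_adjmxD !quat_adjmxM hX hY addrC.
Qed.

(** The real part of the trace; unlike the trace itself it is cyclic over H. *)
Definition rtr X : R := \sum_i q0 (X i i).

Lemma rtrD X Y : rtr (X + Y) = rtr X + rtr Y.
Proof. by rewrite -big_split; apply: eq_bigr => i _; rewrite mxE. Qed.

Lemma rtr0 : rtr 0 = 0.
Proof. by rewrite /rtr big1 // => i _; rewrite mxE. Qed.

Lemma rtrN X : rtr (- X) = - rtr X.
Proof. by apply/eqP; rewrite -addr_eq0 -rtrD addNr rtr0. Qed.

Lemma rtrB X Y : rtr (X - Y) = rtr X - rtr Y.
Proof. by rewrite rtrD rtrN. Qed.

Lemma rtrZ r X : rtr (qreal r *: X) = r * rtr X.
Proof. by rewrite mulr_sumr; apply: eq_bigr => i _; rewrite mxE /=; ring. Qed.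

Lemma rtr1 : rtr 1%:M = n%:R.
Proof.
rewrite /rtr (eq_bigr (fun=> 1)); first by rewrite sumr_const card_ord.
by move=> i _; rewrite mxE eqxx.
Qed.

Lemma rtrC X Y : rtr (X *m Y) = rtr (Y *m X).
Proof.
rewrite /rtr (eq_bigr (fun i => \sum_k q0 (X i k * Y k i))); last first.
  by move=> i _; rewrite mxE q0_sum.
rewrite exchange_big; apply: eq_bigr => k _; rewrite mxE q0_sum.
by apply: eq_bigr => i _; rewrite /=; ring.
Qed.

Lemma rtr_adj_mul X : rtr (quat_adjmx X *m X) = \sum_i \sum_j qnorm (X j i).
Proof.
apply: eq_bigr => i _; rewrite mxE q0_sum; apply: eq_bigr => j _.
by rewrite mxE mul_conj_quat.
Qed.

Lemma rtr_adj_mul_eq0 X : rtr (quat_adjmx X *m X) = 0 -> X = 0.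
Proof.
have ge0 i j : true -> 0 <= qnorm (X j i) by rewrite qnorm_ge0.
rewrite rtr_adj_mul => /eqP; rewrite psumr_eq0; last first.
  by move=> i _; apply: sumr_ge0 => j; exact: ge0.
move=> /allP X0; apply/matrixP=> j i; rewrite [RHS]mxE; apply: qnorm_eq0.
have := X0 i; rewrite mem_index_enum => /(_ isT) /= /eqP/psumr_eq0P.
by move=> /(_ (ge0 i)) ->.
Qed.

Definition el i j x : M := \matrix_(a, b) (x *+ ((a == i) && (b == j))).

Lemma el_herm i x : quat_conj x = x -> qherm (el i i x).
Proof.
move=> hx; apply/matrixP=> a b; rewrite !mxE andbC.
by case: (_ && _); rewrite ?mulr1n ?mulr0n ?hx ?quat_conj0.
Qed.

Lemma adj_el i j x : quat_adjmx (el i j x) = el j i (quat_conj x).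
Proof.
apply/matrixP=> a b; rewrite !mxE andbC.
by case: (_ && _); rewrite ?mulr1n ?mulr0n ?quat_conj0.
Qed.

Lemma mulmx_elE X i j x a b : (X *m el i j x) a b = (X a i * x) *+ (b == j).
Proof.
rewrite mxE (bigD1 i) //= big1 ?addr0; last first.
  by move=> k ki; rewrite mxE (negPf ki) mulr0.
by rewrite mxE eqxx /= mulrnAr.
Qed.

Lemma el_mulmxE X i j x a b : (el i j x *m X) a b = (x * X j b) *+ (a == i).
Proof.
rewrite mxE (bigD1 j) //= big1 ?addr0; last first.
  by move=> k kj; rewrite mxE (negPf kj) andbF mul0r.
by rewrite mxE eqxx andbT mulrnAl.
Qed.

Lemma mul_el i j k l x y :
  el i j x *m el k l y = if j == k then el i l (x * y) else 0.
Proof.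
apply/matrixP=> a b; rewrite mulmx_elE mxE.
case: (altP (j =P k)) => [->|jk]; rewrite mxE ?eqxx ?andbT.
  by case: (_ == i); case: (_ == l); rewrite /= ?mul0r // mul0rn.
by rewrite [k == j]eq_sym (negPf jk) andbF mul0r mul0rn.
Qed.

Lemma el_sandwich X i j x y k l :
  el i j x *m X *m el k l y = el i l (x * X j k * y).
Proof.
apply/matrixP=> a b; rewrite mulmx_elE el_mulmxE mxE.
by case: (_ == i); case: (_ == l); rewrite /= ?mul0r ?mulr0n.
Qed.

Lemma elD i j x y : el i j (x + y) = el i j x + el i j y.
Proof. by apply/matrixP=> a b; rewrite !mxE mulrnDl. Qed.

Lemma elZ r i j x : el i j (qreal r * x) = qreal r *: el i j x.
Proof. by apply/matrixP=> a b; rewrite !mxE mulrnAr. Qed.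

Lemma el_inj i j : injective (el i j).
Proof. by move=> x y /matrixP/(_ i j); rewrite !mxE !eqxx. Qed.

Lemma sum_el : \sum_i el i i 1 = 1%:M.
Proof.
apply/matrixP=> a b; rewrite summxE (bigD1 a) //= big1 ?addr0.
  by rewrite !mxE eqxx /= eq_sym.
by move=> i ia; rewrite mxE eq_sym (negPf ia).
Qed.

Definition unit_idem i := el i i 1.
Definition peirce i j x := el i j x + el j i (quat_conj x).

Lemma unit_idem_herm i : qherm (unit_idem i).
Proof. by apply: el_herm; rewrite quat_conj1. Qed.

Lemma peirce_herm i j x : qherm (peirce i j x).
Proof. by rewrite /qherm quat_adjmxD !adj_el quat_conjK addrC. Qed.

Lemma peirceC i j x : peirce i j x = peirce j i (quat_conj x).
Proof. by rewrite /peirce quat_conjK addrC. Qed.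

(** Cutting out one off-diagonal entry is a Jordan operation, so that a map
  which preserves the product and the diagonal idempotents acts entry by
  entry. *)
Lemma jprod_unit_unit X i j : qherm X -> i != j ->
  jprod (unit_idem i) (jprod (unit_idem j) X) = peirce i j (X i j).
Proof.
move=> hX ij; rewrite /jprod !mulmxDr !mulmxDl !mulmxA.
rewrite -(mulmxA X) !mul_el [j == i]eq_sym (negPf ij).
rewrite mul0mx mulmx0 add0r addr0 !el_sandwich !mul1r !mulr1.
by rewrite /peirce (qhermE _ _ hX).
Qed.

(** The Jordan product of three distinct indices contains the multiplication
  of H. *)
Lemma jprod_peirce i j k x y : i != j -> j != k -> i != k ->
  jprod (peirce i j x) (peirce j k y) = peirce i k (x * y).
Proof.
move=> ij jk ik; rewrite /jprod /peirce !mulmxDl !mulmxDr !mul_el !eqxx.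
rewrite [k == j]eq_sym [j == i]eq_sym [k == i]eq_sym.
by rewrite (negPf ij) (negPf jk) (negPf ik) !add0r !addr0 quat_conjM.
Qed.

Lemma jprod_unit_peircel i j x : i != j ->
  jprod (unit_idem i) (peirce i j x) = peirce i j x.
Proof.
move=> ij; rewrite /jprod /peirce !mulmxDl !mulmxDr !mul_el !eqxx.
by rewrite [j == i]eq_sym (negPf ij) !add0r !addr0 mul1r mulr1.
Qed.

Lemma jprod_unit_peircer i j x : i != j ->
  jprod (unit_idem j) (peirce i j x) = peirce i j x.
Proof. by move=> ij; rewrite peirceC jprod_unit_peircel // eq_sym. Qed.

Lemma peirce_sq i j : i != j ->
  peirce i j 1 *m peirce i j 1 = unit_idem i + unit_idem j.
Proof.
move=> ij; rewrite /peirce !mulmxDl !mulmxDr !mul_el !eqxx.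
by rewrite [j == i]eq_sym (negPf ij) !add0r !addr0 quat_conj1 mulr1.
Qed.

End QuaternionicMatrices.

(** * Jordan endomorphisms of J(n, H) are inner *)

Section JordanEndomorphisms.
Variables (R : realType) (n : nat).
Local Notation H := (quat R).
Local Notation M := 'M[H]_n.
Implicit Types (r : R) (x y : H) (X Y Z A B P : M) (i j k l o : 'I_n).

Lemma quat_double_inj X Y : X + X = Y + Y -> X = Y.
Proof.
move=> /matrixP XY; apply/matrixP=> i j; have := XY i j; rewrite !mxE.
case: (X i j) (Y i j) => [a b c d] [a' b' c' d'] [h0 h1 h2 h3].
by apply: quatP => /=; lra.
Qed.

(** With v a normalized nonzero column of F, the difference F - v v^* is again
  a Hermitian idempotent and has trace 0, hence it vanishes.  The vector v is
  encoded as the square matrix P that has it as its column o, so that only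
  square matrices occur. *)
Lemma rank_one_idempotent F o : qherm F -> F *m F = F -> rtr F = 1 ->
  exists P, [/\ P *m quat_adjmx P = F, quat_adjmx P *m P = unit_idem R o
             & P *m unit_idem R o = P].
Proof.
move=> hF FF tF.
have [j Fj0] : exists j, q0 (F j j) != 0.
  apply: contrapT => F0; have : rtr F = 0.
    apply: big1 => j _; apply/eqP; apply: contrapT => /negP Fj.
    by case: F0; exists j.
  by rewrite tF => /eqP; rewrite oner_eq0.
have Fj_gt0 : 0 < q0 (F j j).
  rewrite lt_neqAle eq_sym Fj0 -{1}FF mxE q0_sum sumr_ge0 // => k _.
  by rewrite -(qhermE j k hF) mul_quat_conj qnorm_ge0.
have FjE : F j j = qreal (q0 (F j j)).
  by apply: quat_real_of_conj; exact: qhermE.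
pose s := (Num.sqrt (q0 (F j j)))^-1.
have ss : s * q0 (F j j) * s = 1.
  rewrite mulrAC -expr2 /s exprVn sqr_sqrtr ?ltW // mulVf //.
pose P := F *m el j o (qreal s).
have Pa : quat_adjmx P = el o j (qreal s) *m F.
  by rewrite quat_adjmxM hF adj_el qreal_conj.
have PP : quat_adjmx P *m P = unit_idem R o.
  rewrite Pa /P mulmxA -[_ *m F *m F]mulmxA FF el_sandwich FjE -!qrealM ss.
  by rewrite qreal1.
have PE : P *m unit_idem R o = P by rewrite /P -mulmxA mul_el eqxx mulr1.
exists P; split=> //; pose G := P *m quat_adjmx P.
have hG : qherm G by rewrite /qherm quat_adjmxM quat_adjmxK.
have FP : F *m P = P by rewrite mulmxA FF.
have FG : F *m G = G by rewrite mulmxA FP.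
have GF : G *m F = G by rewrite -[in LHS]hG -{1}hF -quat_adjmxM FG hG.
have GG : G *m G = G by rewrite /G mulmxA -[_ *m _ *m P]mulmxA PP PE.
apply/eqP; rewrite eq_sym -subr_eq0; apply/eqP; apply: rtr_adj_mul_eq0.
rewrite (qhermB hF hG) mulmxBl !mulmxBr FF FG GF GG subrr subr0 rtrB tF.
rewrite rtrC PP /rtr (bigD1 o) //= big1 ?addr0 ?mxE ?eqxx ?subrr //.
by move=> i io; rewrite mxE (negPf io).
Qed.

(** Multiplying X Y + Y X = 0 by X on either side shows that X and Y
  commute. *)
Lemma orthogonal_idempotents X Y :
  X *m X = X -> Y *m Y = Y -> jprod X Y = 0 -> X *m Y = 0.
Proof.
move=> XX YY XY0.
have h1 : X *m Y + X *m Y *m X = 0.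
  by rewrite -(mulmx0 _ X) -XY0 mulmxDr !mulmxA XX.
have h2 : X *m Y *m X + Y *m X = 0.
  by rewrite -(mul0mx _ X) -XY0 mulmxDl -[in RHS](mulmxA Y) XX.
have XYC : X *m Y = Y *m X.
  by apply: (addIr (X *m Y *m X)); rewrite h1 addrC h2.
by apply: quat_double_inj; rewrite addr0 {2}XYC.
Qed.

Record jordan_endo (f : M -> M) : Prop := JordanEndo {
  jordan_endoD : {morph f : X Y / X + Y};
  jordan_endoZ : forall r X, f (qreal r *: X) = qreal r *: f X;
  jordan_endoH : forall X, qherm X -> qherm (f X);
  jordan_endo_tr : forall X, qherm X -> rtr (f X) = rtr X;
  jordan_endoM : forall X Y, qherm X -> qherm Y ->
    f (jprod X Y) = jprod (f X) (f Y) }.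

Section Theory.
Variable f : M -> M.
Hypothesis fJ : jordan_endo f.

Lemma jordan_endo0 : f 0 = 0.
Proof. by apply: (addrI (f 0)); rewrite -(jordan_endoD fJ) !addr0. Qed.

Lemma jordan_endoB : {morph f : X Y / X - Y}.
Proof.
by move=> X Y; apply/eqP; rewrite eq_sym subr_eq -(jordan_endoD fJ) subrK.
Qed.

Lemma jordan_endo_sq X : qherm X -> f (X *m X) = f X *m f X.
Proof.
move=> hX; apply: quat_double_inj; rewrite -(jordan_endoD fJ).
exact: (jordan_endoM fJ).
Qed.

(** For an idempotent E, twice E X E is E.(E.X) - E.X, where the dot is
  [jprod]. *)
Lemma jordan_endo_sandwich E X : qherm E -> qherm X -> E *m E = E ->
  f (E *m X *m E) = f E *m f X *m f E.
Proof.
move=> hE hX EE; apply: quat_double_inj; rewrite -(jordan_endoD fJ).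
have key (A B : M) : A *m A = A ->
    jprod A (jprod A B) = jprod A B + (A *m B *m A + A *m B *m A).
  move=> AA; rewrite /jprod mulmxDr mulmxDl !mulmxA AA -[B *m A *m A]mulmxA AA.
  by rewrite -!addrA; congr (_ + _); rewrite addrA addrC.
have fEE : f E *m f E = f E by rewrite -jordan_endo_sq // EE.
apply: (addrI (jprod (f E) (f X))).
rewrite -key // -{1}(jordan_endoM fJ) // -(jordan_endoD fJ) -key //.
by rewrite !(jordan_endoM fJ) //; exact: jprod_herm.
Qed.

Lemma jordan_endo_congr A : A *m quat_adjmx A = 1%:M ->
  jordan_endo (fun X => quat_adjmx A *m f X *m A).
Proof.
move=> AA; split=> [X Y|r X|X hX|X hX|X Y hX hY].
- by rewrite (jordan_endoD fJ) mulmxDr mulmxDl.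
- by rewrite (jordan_endoZ fJ) mulmx_realr -scalemxAl.
- by have := qherm_congr (quat_adjmx A) (jordan_endoH fJ hX); rewrite quat_adjmxK.
- by rewrite rtrC mulmxA AA mul1mx jordan_endo_tr.
- have key (U V : M) : quat_adjmx A *m U *m A *m (quat_adjmx A *m V *m A) =
      quat_adjmx A *m (U *m V) *m A.
    by rewrite !mulmxA -[_ *m A *m _]mulmxA AA mulmx1.
  by rewrite (jordan_endoM fJ) // /jprod !key mulmxDr mulmxDl.
Qed.

(** The image of the idempotent of index o is a projection v v^*, and the image
  T_j of the symmetric unit exchanging o and j sends v into the range of the
  j-th projection.  The vectors T_j v are therefore orthonormal, and they are
  the columns of A. *)
Lemma jordan_endo_frame o : exists2 A, quat_adjmx A *m A = 1%:M &
  let g X := quat_adjmx A *m f X *m A in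
  g (unit_idem R o) = unit_idem R o /\
  forall j, o != j -> g (peirce o j 1) = peirce o j 1.
Proof.
pose F j := f (unit_idem R j).
have FH j : qherm (F j) by apply: (jordan_endoH fJ); exact: unit_idem_herm.
have FF j : F j *m F j = F j.
  by rewrite -jordan_endo_sq ?mul_el ?eqxx ?mulr1 //; exact: unit_idem_herm.
have F0 i j : i != j -> F i *m F j = 0.
  move=> ij; apply: orthogonal_idempotents => //.
  rewrite -(jordan_endoM fJ); [|exact: unit_idem_herm..].
  by rewrite /jprod !mul_el [j == i]eq_sym (negPf ij) addr0 jordan_endo0.
have trF : rtr (F o) = 1.
  rewrite (jordan_endo_tr fJ); last exact: unit_idem_herm.
  rewrite /rtr (bigD1 o) //= big1 ?addr0 ?mxE ?eqxx //.
  by move=> i io; rewrite mxE (negPf io).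
have [P [PPa PaP PE]] := rank_one_idempotent o (FH o) (FF o) trF.
have FP : F o *m P = P by rewrite -PPa -mulmxA PaP PE.
pose T j := if j == o then F o else f (peirce o j 1).
have TH j : qherm (T j).
  by rewrite /T; case: ifP => // _; apply/(jordan_endoH fJ)/peirce_herm.
have hS j : qherm (peirce o j (1 : H)) by exact: peirce_herm.
have hE j : qherm (unit_idem R j) by exact: unit_idem_herm.
(* T_j maps the range of F_o into the range of F_j. *)
have FTF j : F j *m T j *m F o = T j *m F o.
  rewrite /T; case: eqP => [->|/eqP jo]; first by rewrite FF.
  rewrite eq_sym in jo.
  rewrite -[in RHS](jprod_unit_peircer 1 jo) (jordan_endoM fJ) // mulmxDl.
  by rewrite -[X in _ + X]mulmxA F0 ?mulmx0 ?addr0 // eq_sym.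
have FTTF j k : F o *m T j *m (T k *m F o) = if j == k then F o else 0.
  have FTFa : F o *m T j *m F j = F o *m T j.
    have := congr1 (@quat_adjmx R n) (FTF j).
    by rewrite !quat_adjmxM !FH TH mulmxA.
  case: (altP (j =P k)) => [<-|jk]; last first.
    rewrite -FTF -FTFa !mulmxA -[_ *m F j *m F k]mulmxA F0 //.
    by rewrite mulmx0 !mul0mx.
  rewrite /T; case: eqP => [_|/eqP jo]; first by rewrite !FF.
  rewrite eq_sym in jo.
  rewrite mulmxA -[_ *m f _ *m f _]mulmxA -jordan_endo_sq // peirce_sq //.
  rewrite (jordan_endoD fJ).
  by rewrite mulmxDr mulmxDl !FF -!/(F _) F0 // mul0mx addr0.
pose A := \sum_j T j *m P *m el o j 1.
have Ael j : A *m el j o 1 = T j *m P.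
  rewrite mulmx_suml (bigD1 j) //= big1 ?addr0.
    by rewrite -!mulmxA mul_el eqxx mulr1 PE.
  by move=> k kj; rewrite -mulmxA mul_el (negPf kj) mulmx0.
have AA : quat_adjmx A *m A = 1%:M.
  rewrite -sum_el quat_adjmx_sum mulmx_suml; apply: eq_bigr => j _.
  have cross k : quat_adjmx (T j *m P *m el o j 1) *m (T k *m P *m el o k 1) =
      if j == k then el j j 1 else 0.
    have -> : quat_adjmx (T j *m P *m el o j 1) *m (T k *m P *m el o k 1) =
        el j o 1 *m (quat_adjmx P *m (F o *m T j *m (T k *m F o)) *m P)
          *m el o k 1.
      by rewrite -{1 2}FP !quat_adjmxM adj_el quat_conj1 TH FH !mulmxA.
    rewrite FTTF; case: eqP => [->|_]; last by rewrite !(mulmx0, mul0mx).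
    rewrite -[_ *m F o *m P]mulmxA FP PaP !mul_el !eqxx !mulr1 mul_el.
    by rewrite eqxx mulr1.
  by rewrite mulmx_sumr (bigD1 j) //= cross eqxx big1 ?addr0 // => k kj;
    rewrite cross eq_sym (negPf kj).
exists A => // g.
have AEo : A *m unit_idem R o = P by rewrite Ael /T eqxx FP.
have gE : g (unit_idem R o) = unit_idem R o.
  rewrite /g -/(F o) -PPa -AEo quat_adjmxM (hE o).
  rewrite !mulmxA AA mul1mx -[_ *m _ *m A]mulmxA AA mulmx1.
  by rewrite /unit_idem mul_el eqxx mulr1.
split=> // j oj; have gJ := jordan_endo_congr (quat_mulmx1C AA).
have gSE : g (peirce o j 1) *m unit_idem R o = el j o 1.
  rewrite /g -mulmxA AEo -mulmxA.
  have -> : f (peirce o j 1) *m P = A *m el j o 1.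
    by rewrite Ael /T eq_sym (negPf oj).
  by rewrite mulmxA AA mul1mx.
have gS : g (peirce o j 1) =
    jprod (g (unit_idem R o)) (g (peirce o j 1)).
  by rewrite -{1}(jprod_unit_peircel 1 oj); apply: (jordan_endoM gJ).
have gSH : qherm (g (peirce o j 1)) by apply: (jordan_endoH gJ).
rewrite gS gE /jprod gSE -{1}(hE o) -{1}gSH -quat_adjmxM gSE adj_el.
by rewrite /peirce quat_conj1.
Qed.

End Theory.
End JordanEndomorphisms.

Section Normalized.
Variables (R : realType) (m : nat).
Local Notation n := m.+3.
Local Notation H := (quat R).
Local Notation M := 'M[H]_n.
Implicit Types (r : R) (x y : H) (X Y Z A B P : M) (i j k l : 'I_n).

(** The diagonal idempotents and all symmetric units are generated by the
  fixed elements, so g maps each off-diagonal entry x to phi x with a map phi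
  that does not depend on the position.  Three distinct indices make phi
  multiplicative; hence n >= 3. *)
Lemma jordan_endo_normalized (g : M -> M) : jordan_endo g ->
    g (unit_idem R ord0) = unit_idem R ord0 ->
    (forall j, ord0 != j -> g (peirce ord0 j 1) = peirce ord0 j 1) ->
  exists2 p : H, quat_conj p * p = 1 &
    forall X, qherm X -> forall i j, g X i j = p * X i j * quat_conj p.
Proof.
move=> gJ gE0 gS0.
have hP i j x : qherm (peirce i j x) by exact: peirce_herm.
have gE j : g (unit_idem R j) = unit_idem R j.
  case: (eqVneq ord0 j) => [<-//|j0].
  have -> : unit_idem R j = peirce ord0 j 1 *m peirce ord0 j 1 - unit_idem R ord0.
    by rewrite peirce_sq // addrC addKr.
  by rewrite (jordan_endoB gJ) (jordan_endo_sq gJ) // gS0 // gE0.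
have gS i j : i != j -> g (peirce i j 1) = peirce i j 1.
  case: (eqVneq ord0 i) => [<-|i0 ij]; first exact: gS0.
  case: (eqVneq ord0 j) => [<-|j0].
    by rewrite peirceC quat_conj1 gS0.
  have i0' : i != ord0 by rewrite eq_sym.
  rewrite -[1]mulr1 -(jprod_peirce _ _ i0' j0 ij) (jordan_endoM gJ) //.
  by rewrite gS0 // peirceC quat_conj1 gS0.
have gP i j x : i != j -> g (peirce i j x) = peirce i j (g (peirce i j x) i j).
  move=> ij; have gPH : qherm (g (peirce i j x)) by apply: (jordan_endoH gJ).
  rewrite -(jprod_unit_unit gPH ij) -{1}(gE i) -{1}(gE j).
  rewrite -!(jordan_endoM gJ) //; try exact: unit_idem_herm; last first.
    by apply: jprod_herm => //; exact: unit_idem_herm.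
  by rewrite jprod_unit_peircer // jprod_unit_peircel.
pose phi i j x := g (peirce i j x) i j.
have phiP i j x : i != j -> g (peirce i j x) = peirce i j (phi i j x).
  exact: gP.
have Pij i j x : i != j -> peirce i j x i j = x.
  by move=> ij; rewrite !mxE !eqxx [j == i]eq_sym (negPf ij) addr0.
have phiM i j k x y : i != j -> j != k -> i != k ->
    phi i k (x * y) = phi i j x * phi j k y.
  move=> ij jk ik; rewrite {1}/phi -(jprod_peirce _ _ ij jk ik).
  by rewrite (jordan_endoM gJ) // !phiP // jprod_peirce // Pij.
have phi1 i j : i != j -> phi i j 1 = 1.
  by move=> ij; rewrite /phi gS // Pij.
have phir i j k x : i != j -> i != k -> phi i j x = phi i k x.
  move=> ij ik; case: (eqVneq j k) => [->//|jk].
  by rewrite -[x in RHS]mulr1 (phiM i j k) // phi1 // mulr1.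
have phil i j k x : i != k -> j != k -> phi i k x = phi j k x.
  move=> ik jk; case: (eqVneq i j) => [->//|ij].
  by rewrite -[x in LHS]mul1r (phiM i j k) // phi1 // mul1r.
pose o1 : 'I_n := Ordinal (isT : 1 < n)%N.
pose o2 : 'I_n := Ordinal (isT : 2 < n)%N.
(* Changing one index at a time, any position is moved to (0, 1); a position
   (i, 0) first passes through a third index k. *)
have phi_const i j x : i != j -> phi i j x = phi ord0 o1 x.
  case: (eqVneq ord0 j) => [<-|j0] ij; last first.
    by rewrite (phil i ord0 j) // (phir ord0 j o1).
  have [k [k0 ik]] : exists k, ord0 != k /\ i != k.
    by case: (eqVneq i o1) => [->|io]; [exists o2|exists o1].
  by rewrite (phir i ord0 k) // (phil i ord0 k) // (phir ord0 k o1).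
have phi_mul : {morph phi ord0 o1 : x y / x * y}.
  move=> x y; rewrite -(phi_const ord0 o2) // (phiM ord0 o1 o2) //.
  by rewrite (phi_const o1 o2).
have phiD : {morph phi ord0 o1 : x y / x + y}.
  move=> x y; rewrite /phi.
  have -> : peirce ord0 o1 (x + y) = peirce ord0 o1 x + peirce ord0 o1 y.
    by rewrite /peirce quat_conjD !elD addrACA.
  by rewrite (jordan_endoD gJ) mxE.
have phiZ r x : phi ord0 o1 (qreal r * x) = qreal r * phi ord0 o1 x.
  have e : peirce ord0 o1 (qreal r * x) = qreal r *: peirce ord0 o1 x.
    by rewrite /peirce scalerDr quat_conjM qreal_conj qrealC !elZ.
  by rewrite /phi e (jordan_endoZ gJ) mxE.
have [p pp phiE] := quat_inner (phi1 ord0 o1 isT) phiD phi_mul phiZ.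
have pp' : p * quat_conj p = 1.
  by rewrite mul_quat_conj; rewrite mul_conj_quat in pp.
exists p => // X hX i j; have gXH : qherm (g X) by apply: (jordan_endoH gJ).
case: (eqVneq i j) => [<-|ij]; last first.
  rewrite -(phiE (X i j)) -(phi_const i j) //.
  rewrite /phi -(jprod_unit_unit hX ij) !(jordan_endoM gJ) ?gE;
    rewrite ?jprod_unit_unit ?Pij //;
    by [exact: unit_idem_herm | apply: jprod_herm => //; exact: unit_idem_herm].
have hE : qherm (unit_idem R i : M) by exact: unit_idem_herm.
have EE : unit_idem R i *m unit_idem R i = unit_idem R i :> M.
  by rewrite mul_el eqxx mulr1.
have XiE : X i i = qreal (q0 (X i i)).
  by apply: quat_real_of_conj; exact: qhermE.
have := jordan_endo_sandwich gJ hE hX EE.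
rewrite gE !el_sandwich !mul1r !mulr1 {1}XiE -[qreal _]mulr1 elZ.
rewrite (jordan_endoZ gJ) -/(unit_idem R i) gE -elZ mulr1 => /el_inj <-.
by rewrite XiE qrealC -mulrA pp' mulr1.
Qed.

Theorem jordan_endo_inner (f : M -> M) : jordan_endo f ->
  exists2 A : M, quat_adjmx A *m A = 1%:M &
    forall X, qherm X -> f X = A *m X *m quat_adjmx A.
Proof.
move=> fJ; have [A AA [gE gS]] := jordan_endo_frame fJ ord0.
have AA' := quat_mulmx1C AA.
have [p pp gX] := jordan_endo_normalized (jordan_endo_congr fJ AA') gE gS.
pose D : M := p%:M.
have DE X i j : (D *m X *m quat_adjmx D) i j = p * X i j * quat_conj p.
  rewrite mul_scalar_mx mxE (bigD1 j) //= big1 ?addr0.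
    by rewrite !mxE eqxx.
  by move=> k kj; rewrite !mxE eq_sym (negPf kj) mulr0n quat_conj0 mulr0.
exists (A *m D).
  rewrite quat_adjmxM mulmxA -[_ *m _ *m A]mulmxA AA mulmx1.
  have -> : quat_adjmx D = (quat_conj p)%:M.
    apply/matrixP=> i j; rewrite !mxE eq_sym.
    by case: eqP; rewrite ?mulr1n ?mulr0n ?quat_conj0.
  by rewrite -scalar_mxM pp.
move=> X hX; have -> : A *m D *m X *m quat_adjmx (A *m D) =
    A *m (D *m X *m quat_adjmx D) *m quat_adjmx A.
  by rewrite quat_adjmxM !mulmxA.
have -> : D *m X *m quat_adjmx D = quat_adjmx A *m f X *m A.
  by apply/matrixP=> i j; rewrite DE gX.
by rewrite !mulmxA AA' mul1mx -mulmxA AA' mulmx1.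
Qed.

End Normalized.

(** * Maps preserving the traces of powers *)

Lemma cubic_polar (R : realType) (V : zmodType) (T : V -> V -> V -> R) :
    (forall a a' b c, T (a + a') b c = T a b c + T a' b c) ->
    (forall a b b' c, T a (b + b') c = T a b c + T a b' c) ->
    (forall a b c c', T a b (c + c') = T a b c + T a b c') ->
    (forall a b c, T a b c = T b c a) ->
  forall x y z,
    T (x + y + z) (x + y + z) (x + y + z) - T (x + y) (x + y) (x + y)
      - T (y + z) (y + z) (y + z) - T (x + z) (x + z) (x + z)
      + T x x x + T y y y + T z z z = 3 * (T x y z + T y x z).
Proof.
move=> T1 T2 T3 Tcyc x y z.
rewrite !T1 !T2 !T3.
rewrite (Tcyc y z x) (Tcyc z x y) (Tcyc x z y) (Tcyc z y x).
ring.
Qed.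

Section TraceForms.
Variables (R : realType) (n : nat).
Local Notation M := 'M[quat R]_n.
Implicit Types (X Y Z W : M).

Definition rtr2 X := rtr (X *m X).
Definition rtr3 X := rtr (X *m X *m X).

Lemma rtr2_polar X Y : rtr2 (X + Y) - rtr2 X - rtr2 Y = 2 * rtr (X *m Y).
Proof.
rewrite /rtr2 mulmxDl !mulmxDr rtrD rtrD rtrD (rtrC Y X).
by move: (rtr (X *m X)) (rtr (X *m Y)) (rtr (Y *m Y)) => a b c; ring.
Qed.

Lemma rtr3_polar X Y Z :
  rtr3 (X + Y + Z) - rtr3 (X + Y) - rtr3 (Y + Z) - rtr3 (X + Z)
    + rtr3 X + rtr3 Y + rtr3 Z = 3 * rtr (jprod X Y *m Z).
Proof.
rewrite /jprod mulmxDl rtrD.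
apply: (cubic_polar (T := fun A B C : M => rtr (A *m B *m C))).
- by move=> A A' B C; rewrite !mulmxDl rtrD.
- by move=> A B B' C; rewrite mulmxDr mulmxDl rtrD.
- by move=> A B C C'; rewrite mulmxDr rtrD.
- by move=> A B C; rewrite -mulmxA rtrC.
Qed.

(** The polarized square and cube of the trace express
  Re tr ((f X . f Y - f (X . Y)) (f Z)) = 0 for all Z; since f is onto and the
  trace form is definite, the first factor is zero. *)
Lemma jordan_endo_of_traces (f h : M -> M) :
    {morph f : X Y / X + Y} ->
    (forall r X, f (qreal r *: X) = qreal r *: f X) ->
    (forall X, qherm X -> qherm (f X)) ->
    (forall X, qherm X -> qherm (h X)) ->
    (forall X, qherm X -> f (h X) = X) ->
    (forall X, qherm X -> rtr (f X) = rtr X) ->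
    (forall X, qherm X -> rtr2 (f X) = rtr2 X) ->
    (forall X, qherm X -> rtr3 (f X) = rtr3 X) ->
  jordan_endo f.
Proof.
move=> fD fZ fH hH fK ft f2 f3.
have two0 : (2 : R) != 0 by rewrite pnatr_eq0.
have three0 : (3 : R) != 0 by rewrite pnatr_eq0.
have form2 X Y : qherm X -> qherm Y -> rtr (f X *m f Y) = rtr (X *m Y).
  move=> hX hY; have hXY := qhermD hX hY.
  have := rtr2_polar X Y.
  by rewrite -(f2 _ hXY) -(f2 _ hX) -(f2 _ hY) fD rtr2_polar => /(mulfI two0).
have form3 X Y Z : qherm X -> qherm Y -> qherm Z ->
    rtr (jprod (f X) (f Y) *m f Z) = rtr (jprod X Y *m Z).
  move=> hX hY hZ; have hXY := qhermD hX hY; have hYZ := qhermD hY hZ.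
  have hXZ := qhermD hX hZ; have hXYZ := qhermD hXY hZ.
  have := rtr3_polar X Y Z.
  rewrite -(f3 _ hXYZ) -(f3 _ hXY) -(f3 _ hXZ) -(f3 _ hYZ) -(f3 _ hX).
  by rewrite -(f3 _ hY) -(f3 _ hZ) !fD rtr3_polar => /(mulfI three0).
split=> // X Y hX hY.
have hJ := jprod_herm hX hY.
pose D := f (jprod X Y) - jprod (f X) (f Y).
have hD : qherm D by apply: qhermB; [apply: fH|apply: jprod_herm; apply: fH].
have D0 W : qherm W -> rtr (D *m W) = 0.
  move=> hW; have hhW := hH W hW; rewrite -(fK W hW) /D mulmxBl rtrB.
  by rewrite (form2 _ _ hJ hhW) (form3 _ _ _ hX hY hhW) subrr.
have -> : f (jprod X Y) = D + jprod (f X) (f Y) by rewrite subrK.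
by rewrite (@rtr_adj_mul_eq0 R n D) ?add0r // hD; exact: D0.
Qed.

End TraceForms.

(** * Coordinates on J and on the real form *)

Local Notation p0 := (@Ordinal 3 0 isT).
Local Notation p1 := (@Ordinal 3 1 isT).
Local Notation p2 := (@Ordinal 3 2 isT).
Local Notation s0 := (@Ordinal 4 0 isT).
Local Notation s1 := (@Ordinal 4 1 isT).
Local Notation s2 := (@Ordinal 4 2 isT).
Local Notation s3 := (@Ordinal 4 3 isT).

Lemma ord3_ind (P : 'I_3 -> Prop) : P p0 -> P p1 -> P p2 -> forall i, P i.
Proof.
by move=> ? ? ? [[|[|[|k]]] ki] //; rewrite (bool_irrelevance ki isT).
Qed.

Lemma ord4_ind (P : 'I_4 -> Prop) :
  P s0 -> P s1 -> P s2 -> P s3 -> forall i, P i.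
Proof.
by move=> ? ? ? ? [[|[|[|[|k]]]] ki] //; rewrite (bool_irrelevance ki isT).
Qed.

Lemma sum_ord3 (V : nmodType) (F : 'I_3 -> V) :
  \sum_i F i = F p0 + F p1 + F p2.
Proof.
rewrite !big_ord_recl big_ord0 addr0 addrA.
by congr (F _ + F _ + F _); apply/val_inj.
Qed.

Lemma sum_ord4 (V : nmodType) (F : 'I_4 -> V) :
  \sum_i F i = F s0 + F s1 + F s2 + F s3.
Proof.
rewrite !big_ord_recl big_ord0 addr0 !addrA.
by congr (F _ + F _ + F _ + F _); apply/val_inj.
Qed.

Section Coordinates.
Variable R : realType.
Local Notation H := (quat R).
Local Notation C := (cayley R).
Implicit Types (r : R) (x y z : C).

Lemma cayP x y : cay_m x = cay_m y -> cay_a x = cay_a y -> x = y.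
Proof. by case: x y => [? ?] [? ?] /= -> ->. Qed.

(** The Euclidean inner product of the Cayley algebra. *)
Definition cdot x y : R := q0 (cay_m (cay_mul x (cay_conj y))).

(** The off-diagonal coordinates follow Freudenthal: x, y and z stand at the
  positions (1,2), (2,0) and (0,1), so that the cross product is invariant
  under cyclic permutation of the indices. *)
Definition herm3_mx (a b c : R) x y z : 'M[C]_3 := \matrix_(i, j)
  match val i, val j with
  | 0%N, 0%N => Cayley (qreal a) 0
  | 1%N, 1%N => Cayley (qreal b) 0
  | 2%N, 2%N => Cayley (qreal c) 0
  | 1%N, 2%N => x
  | 2%N, 1%N => cay_conj x
  | 2%N, 0%N => y
  | 0%N, 2%N => cay_conj y
  | 0%N, 1%N => z
  | _, _ => cay_conj z
  end.

Lemma cay_conjK : involutive (@cay_conj R).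
Proof. by move=> x; apply: cayP; rewrite /= ?quat_conjK ?opprK. Qed.

Lemma herm3_mx_herm a b c x y z : herm3_mx a b c x y z \in @cay_hermitian R.
Proof.
apply/eqP/matrixP; apply: ord3_ind; apply: ord3_ind;
by rewrite !mxE //= ?cay_conjK //; apply: cayP; rewrite //= ?qreal_conj ?oppr0.
Qed.

Definition herm3 a b c x y z : J R := MkJ (herm3_mx_herm a b c x y z).

Lemma herm3E (X : J R) : X = herm3
  (q0 (cay_m (X p0 p0))) (q0 (cay_m (X p1 p1))) (q0 (cay_m (X p2 p2)))
  (X p1 p2) (X p2 p0) (X p0 p1).
Proof.
have diag i : X i i = Cayley (qreal (q0 (cay_m (X i i)))) 0.
  have := J_hermE X i i; case: (X i i) => m a [hm ha].
  apply: cayP => /=; first by apply: quat_real_of_conj.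
  by case: a ha => a b c d [? ? ? ?]; apply: quatP => /=; lra.
apply/val_inj/matrixP; apply: ord3_ind; apply: ord3_ind;
by rewrite !mxE //= ?J_hermE.
Qed.

Lemma jtr_herm3 a b c x y z : jtr (herm3 a b c x y z) = a + b + c.
Proof. by rewrite /jtr sum_ord3 !mxE /=. Qed.

Lemma jform_herm3 a b c x y z a' b' c' x' y' z' :
  jform (herm3 a b c x y z) (herm3 a' b' c' x' y' z') =
  a * a' + b * b' + c * c' + 2 * (cdot x x' + cdot y y' + cdot z z').
Proof.
rewrite /jform /jtr sum_ord3 !mxE !sum_ord3 !mxE /= /cdot /=.
by field.
Qed.

Lemma jcross_herm3 a b c x y z a' b' c' x' y' z' :
  jcross (herm3 a b c x y z) (herm3 a' b' c' x' y' z') =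
  herm3 (2^-1 * (b * c' + c * b') - cdot x x')
      (2^-1 * (c * a' + a * c') - cdot y y')
      (2^-1 * (a * b' + b * a') - cdot z z')
      (2^-1 *: (cay_conj (cay_mul y z' + cay_mul y' z) - a *: x' - a' *: x))
      (2^-1 *: (cay_conj (cay_mul z x' + cay_mul z' x) - b *: y' - b' *: y))
      (2^-1 *: (cay_conj (cay_mul x y' + cay_mul x' y) - c *: z' - c' *: z)).
Proof.
rewrite [LHS]herm3E.
congr herm3; rewrite /jcross !mxE !sum_ord3 !mxE jform_herm3 !jtr_herm3 /=;
  rewrite ?/cdot /=; try (apply: cayP; apply: quatP); rewrite /=; by field.
Qed.

Implicit Types (t : R) (a m : H).

(** The traceless Hermitian matrix with first row (t/2, a) and lower block
  M - t/2, where M has diagonal (t1, t2, t3) and off-diagonal coordinates m,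
  and t = t1 + t2 + t3. *)
Definition herm4 t1 t2 t3 a1 a2 a3 m1 m2 m3 : 'M[H]_4 := \matrix_(i, j)
  match val i, val j with
  | 0%N, 0%N => qreal ((t1 + t2 + t3) / 2)
  | 1%N, 1%N => qreal ((t1 - t2 - t3) / 2)
  | 2%N, 2%N => qreal ((t2 - t1 - t3) / 2)
  | 3%N, 3%N => qreal ((t3 - t1 - t2) / 2)
  | 0%N, 1%N => a1
  | 1%N, 0%N => quat_conj a1
  | 0%N, 2%N => a2
  | 2%N, 0%N => quat_conj a2
  | 0%N, _ => a3
  | _, 0%N => quat_conj a3
  | 1%N, 2%N => m3
  | 2%N, 1%N => quat_conj m3
  | 2%N, 3%N => m1
  | 3%N, 2%N => quat_conj m1
  | 3%N, _ => m2
  | _, _ => quat_conj m2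
  end.

(** A general point M + i a e4 of the real form. *)
Definition real_point t1 t2 t3 a1 a2 a3 m1 m2 m3 : JC R :=
  Cplx (herm3 t1 t2 t3 (Cayley m1 0) (Cayley m2 0) (Cayley m3 0))
       (herm3 0 0 0 (Cayley 0 a1) (Cayley 0 a2) (Cayley 0 a3)).

(** This reads the coordinates of the component in V of an arbitrary element of
  J^C = V + iV. *)
Definition to_herm (X : JC R) : 'M[H]_4 :=
  let P := cre X in let Q := cim X in
  herm4 (q0 (cay_m (P p0 p0))) (q0 (cay_m (P p1 p1))) (q0 (cay_m (P p2 p2)))
    (cay_a (Q p1 p2)) (cay_a (Q p2 p0)) (cay_a (Q p0 p1))
    (cay_m (P p1 p2)) (cay_m (P p2 p0)) (cay_m (P p0 p1)).

(** The diagonal is read through combinations that vanish on scalar matrices,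
  so that the traceless part alone matters. *)
Definition of_herm (B : 'M[H]_4) : JC R :=
  let b i := q0 (B i i) in
  real_point ((b s0 + b s1 - b s2 - b s3) / 2)
    ((b s0 + b s2 - b s1 - b s3) / 2) ((b s0 + b s3 - b s1 - b s2) / 2)
    (B s0 s1) (B s0 s2) (B s0 s3) (B s2 s3) (B s3 s1) (B s1 s2).

Lemma herm4_qherm t1 t2 t3 a1 a2 a3 m1 m2 m3 :
  qherm (herm4 t1 t2 t3 a1 a2 a3 m1 m2 m3).
Proof.
apply/matrixP; apply: ord4_ind; apply: ord4_ind; rewrite !mxE //=;
  by rewrite ?quat_conjK ?qreal_conj.
Qed.

Lemma to_herm_real_point (t1 t2 t3 : R) (a1 a2 a3 m1 m2 m3 : H) :
  to_herm (real_point t1 t2 t3 a1 a2 a3 m1 m2 m3) =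
  herm4 t1 t2 t3 a1 a2 a3 m1 m2 m3.
Proof. by rewrite /to_herm /real_point !mxE. Qed.

Lemma to_herm_of_herm B : qherm B ->
  to_herm (of_herm B) = B - qreal (rtr B / 4) *: 1%:M.
Proof.
move=> hB; have diag i : B i i = qreal (q0 (B i i)).
  by apply: quat_real_of_conj; exact: qhermE.
rewrite /of_herm to_herm_real_point /rtr sum_ord4.
apply/matrixP; apply: ord4_ind; apply: ord4_ind;
  rewrite !mxE ?mulr1n ?mulr0n ?mulr0 ?subr0 /= ?(qhermE _ _ hB) //;
  by rewrite [in RHS]diag; apply: quatP => /=; field.
Qed.

End Coordinates.

Section Forms.
Variable R : realType.
Local Notation H := (quat R).
Local Notation C := (cayley R).
Implicit Types (r t : R) (x y z : C).

Lemma herm3D (a b c : R) x y z a' b' c' x' y' z' :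
  herm3 a b c x y z + herm3 a' b' c' x' y' z' =
  herm3 (a + a') (b + b') (c + c') (x + x') (y + y') (z + z').
Proof.
apply/val_inj/matrixP; apply: ord3_ind; apply: ord3_ind; rewrite !mxE //=;
  by rewrite ?cay_conjD //; apply: cayP; apply: quatP; rewrite /= ?addr0.
Qed.

Lemma herm3N (a b c : R) x y z :
  - herm3 a b c x y z = herm3 (- a) (- b) (- c) (- x) (- y) (- z).
Proof.
apply/eqP; rewrite eq_sym -addr_eq0 herm3D !addNr; apply/eqP.
by apply/val_inj/matrixP; apply: ord3_ind; apply: ord3_ind;
  rewrite !mxE //= ?cay_conj0.
Qed.

Lemma real_complexM (r s t : R) : r%:C * (s +i* t) = (r * s) +i* (r * t).
Proof. by simpc. Qed.

Lemma jcdetE (P Q : J R) : jcdet (Cplx P Q) =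
  (3^-1 * (jform P (jcross P P - jcross Q Q)
             - jform Q (jcross P Q + jcross Q P)))
  +i* (3^-1 * (jform P (jcross P Q + jcross Q P)
                 + jform Q (jcross P P - jcross Q Q))).
Proof.
rewrite /jcdet /jcform /jccross /cplx_map2 /cplx_form /=.
have -> : (3^-1 : R[i]) = (3^-1)%:C by rewrite fmorphV rmorph_nat.
by rewrite real_complexM.
Qed.

(** With N = M - t/2, the trace of the cube of [herm4] is
  3 (tr M^3 / 3 - t tr M^2 / 2 + t^3 / 6 + Re a M a^* ).  The first three
  terms are det M.  The last one is the contribution of i a e4: the terms of
  the determinant quadratic in the e4-parts occur with the sign of i^2. *)
Lemma jcdet_real_point t1 t2 t3 a1 a2 a3 m1 m2 m3 :
  jcdet (real_point t1 t2 t3 a1 a2 a3 m1 m2 m3) =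
  (3^-1 * rtr3 (herm4 t1 t2 t3 a1 a2 a3 m1 m2 m3))%:C.
Proof.
rewrite jcdetE !jcross_herm3 !herm3N !herm3D !jform_herm3.
congr (_ +i* _); last first.
  by rewrite /cdot /=; ring.
congr (_ * _).
rewrite /rtr3 /rtr sum_ord4 !mxE !sum_ord4 !mxE !sum_ord4 !mxE.
by rewrite /cdot /=; field.
Qed.

Lemma jcherm_real_point t1 t2 t3 a1 a2 a3 m1 m2 m3
    t1' t2' t3' a1' a2' a3' m1' m2' m3' :
  jcherm (real_point t1 t2 t3 a1 a2 a3 m1 m2 m3)
    (real_point t1' t2' t3' a1' a2' a3' m1' m2' m3') =
  (rtr (herm4 t1 t2 t3 a1 a2 a3 m1 m2 m3 *m
        herm4 t1' t2' t3' a1' a2' a3' m1' m2' m3'))%:C.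
Proof.
rewrite /jcherm /jcform /jctau /cplx_tau /cplx_form /real_point /=.
rewrite !herm3N !jform_herm3.
congr (_ +i* _); last first.
  by rewrite /cdot /=; ring.
rewrite /rtr sum_ord4 !mxE !sum_ord4 !mxE.
by rewrite /cdot /=; field.
Qed.

End Forms.

(** * Complex forms from their values on the real form *)

Lemma additive_opp (U V : zmodType) (f : U -> V) :
  {morph f : x y / x + y} -> {morph f : x / - x}.
Proof.
move=> fD x; have f0 : f 0 = 0.
  by apply: (addrI (f 0)); rewrite -fD !addr0.
by apply/eqP; rewrite -addr_eq0 -fD addNr f0.
Qed.

(** For a trilinear T, the values q (x + y) and q (x - y) determine the two
  mixed terms of q (x + c y), for every scalar c; here c = ii. *)
Lemma cubic_imaginary (K : fieldType) (V : lmodType K) (ii : K)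
    (T : V -> V -> V -> K) : (2 : K) != 0 -> ii * ii = -1 ->
    (forall b c, {morph (fun a => T a b c) : x y / x + y}) ->
    (forall a c, {morph (fun b => T a b c) : x y / x + y}) ->
    (forall a b, {morph (fun c => T a b c) : x y / x + y}) ->
    (forall a b c, T (ii *: a) b c = ii * T a b c) ->
    (forall a b c, T a (ii *: b) c = ii * T a b c) ->
    (forall a b c, T a b (ii *: c) = ii * T a b c) ->
  let q x := T x x x in
  forall x y, q (x + ii *: y) =
    2 * q x - (q (x + y) + q (x - y)) / 2
      + ii * ((q (x + y) - q (x - y)) / 2 - 2 * q y).
Proof.
move=> two0 ii2 T1 T2 T3 Z1 Z2 Z3 q x y; rewrite /q.
have N1 b c a := additive_opp (T1 b c) a.
have N2 a c b := additive_opp (T2 a c) b.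
have N3 a b c := additive_opp (T3 a b) c.
move: N1 N2 N3 => /= N1 N2 N3.
rewrite !T1 !T2 !T3 !(Z1, Z2, Z3) !(N1, N2, N3).
by field: ii2.
Qed.

Section Polar.
Variable R : realType.
Local Notation H := (quat R).
Local Notation C := (cayley R).
Implicit Types (r t : R) (P Q S : J R).

Lemma jformDr P Q S : jform P (Q + S) = jform P Q + jform P S.
Proof.
rewrite (herm3E P) (herm3E Q) (herm3E S) herm3D !jform_herm3 /cdot /=; ring.
Qed.

Lemma jformC P Q : jform P Q = jform Q P.
Proof. by rewrite /jform /jtr; apply: eq_bigr => i _; rewrite !mxE addrC. Qed.

Lemma jformDl P Q S : jform (P + Q) S = jform P S + jform Q S.
Proof. by rewrite jformC jformDr !(jformC S). Qed.

Lemma jordanC P Q : jordan P Q = jordan Q P.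
Proof. by apply/val_inj/matrixP => i j; rewrite !mxE addrC. Qed.

Lemma jcrossC P Q : jcross P Q = jcross Q P.
Proof.
rewrite /jcross jordanC jformC (mulrC (jtr P)).
by rewrite [_ - jtr P *: Q - _]addrAC.
Qed.

Lemma jcrossDr P Q S : jcross P (Q + S) = jcross P Q + jcross P S.
Proof.
rewrite (herm3E P) (herm3E Q) (herm3E S) herm3D !jcross_herm3 herm3D.
congr herm3; try (apply: cayP; apply: quatP); rewrite /cdot /=; by field.
Qed.

Lemma jcrossDl P Q S : jcross (P + Q) S = jcross P S + jcross Q S.
Proof. by rewrite jcrossC jcrossDr !(jcrossC S). Qed.

Lemma jformNl P Q : jform (- P) Q = - jform P Q.
Proof. by apply: (additive_opp (fun P P' => jformDl P P' Q)). Qed.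

Lemma jformNr P Q : jform P (- Q) = - jform P Q.
Proof. by rewrite jformC jformNl jformC. Qed.

Lemma jcrossNl P Q : jcross (- P) Q = - jcross P Q.
Proof. by apply: (additive_opp (fun P P' => jcrossDl P P' Q)). Qed.

Lemma jcrossNr P Q : jcross P (- Q) = - jcross P Q.
Proof. by rewrite jcrossC jcrossNl jcrossC. Qed.

Definition ii : R[i] := 0 +i* 1.

Lemma ii_sq : ii * ii = -1.
Proof. by rewrite /ii; simpc. Qed.

Implicit Types X Y Z : JC R.

Lemma ii_scale X : ii *: X = Cplx (- cim X) (cre X) :> JC R.
Proof.
by rewrite /ii; congr Cplx; rewrite /= ?scale0r scale1r ?add0r.
Qed.

Lemma complex_eq (x y : R[i]) :
  complex.Re x = complex.Re y -> complex.Im x = complex.Im y -> x = y.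
Proof. by case: x y => [a b] [c d] /= -> ->. Qed.

Lemma jcformDr X Y Z : jcform X (Y + Z) = jcform X Y + jcform X Z.
Proof.
rewrite /jcform /cplx_form /= !jformDr.
by apply: complex_eq => /=; ring.
Qed.

Lemma jcformC X Y : jcform X Y = jcform Y X.
Proof.
rewrite /jcform /cplx_form !(jformC (cre Y)) !(jformC (cim Y)).
by congr (_ +i* _); rewrite addrC.
Qed.

Lemma jcformDl X Y Z : jcform (X + Y) Z = jcform X Z + jcform Y Z.
Proof. by rewrite jcformC jcformDr !(jcformC Z). Qed.

Lemma jcformIr X Y : jcform X (ii *: Y) = ii * jcform X Y.
Proof.
rewrite ii_scale /jcform /cplx_form /= !jformNr /ii.
by apply: complex_eq => /=; ring.
Qed.

Lemma jcformIl X Y : jcform (ii *: X) Y = ii * jcform X Y.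
Proof. by rewrite jcformC jcformIr jcformC. Qed.

Lemma jccrossDr X Y Z : jccross X (Y + Z) = jccross X Y + jccross X Z.
Proof.
rewrite /jccross /cplx_map2 /= !jcrossDr.
by congr Cplx; rewrite /= ?opprD addrACA.
Qed.

Lemma jccrossC X Y : jccross X Y = jccross Y X.
Proof.
rewrite /jccross /cplx_map2 !(jcrossC (cre Y)) !(jcrossC (cim Y)).
by rewrite [X in Cplx _ X]addrC.
Qed.

Lemma jccrossDl X Y Z : jccross (X + Y) Z = jccross X Z + jccross Y Z.
Proof. by rewrite jccrossC jccrossDr !(jccrossC Z). Qed.

Lemma jccrossIr X Y : jccross X (ii *: Y) = ii *: jccross X Y.
Proof.
rewrite !ii_scale /jccross /cplx_map2 /= !jcrossNr.
by congr Cplx; rewrite ?opprD // addrC.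
Qed.

Lemma jccrossIl X Y : jccross (ii *: X) Y = ii *: jccross X Y.
Proof. by rewrite jccrossC jccrossIr jccrossC. Qed.

Lemma jcdet_imaginary X Y : jcdet (X + ii *: Y) =
  2 * jcdet X - (jcdet (X + Y) + jcdet (X - Y)) / 2
    + ii * ((jcdet (X + Y) - jcdet (X - Y)) / 2 - 2 * jcdet Y).
Proof.
rewrite /jcdet.
have -> := @cubic_imaginary R[i] (JC R) ii
  (fun U V W => jcform U (jccross V W)) _ ii_sq.
- by move: (jcform _ _) (jcform _ _) (jcform _ _) (jcform _ _) => a b c d; ring.
- by rewrite pnatr_eq0.
- by move=> b c U V; rewrite jcformDl.
- by move=> b c U V; rewrite jccrossDl jcformDr.
- by move=> b c U V; rewrite jccrossDr jcformDr.
- by move=> a b c; rewrite jcformIl.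
- by move=> a b c; rewrite jccrossIl jcformIr.
- by move=> a b c; rewrite jccrossIr jcformIr.
Qed.

Lemma jcherm_imaginary X Y X' Y' :
  jcherm (X + ii *: Y) (X' + ii *: Y') =
  jcherm X X' + jcherm Y Y' + ii * (jcherm X Y' - jcherm Y X').
Proof.
have tauE (U V : JC R) : jctau (U + ii *: V) = jctau U + ii *: - jctau V.
  by rewrite !ii_scale; congr Cplx; rewrite /= ?opprK ?opprD.
have formN (U V : JC R) : jcform (- U) V = - jcform U V.
  have -> : - U = Cplx (- cre U) (- cim U) :> JC R by [].
  rewrite /jcform /cplx_form /= !jformNl.
  by apply: complex_eq => /=; ring.
rewrite /jcherm tauE !jcformDl !jcformDr !jcformIl !jcformIr !formN.
move: (jcform _ _) (jcform _ _) (jcform _ _) (jcform _ _) => a b c d.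
by ring: ii_sq.
Qed.

End Polar.

(** * The real form of J^C *)

Section RealForm.
Variable R : realType.
Local Notation H := (quat R).
Local Notation M := 'M[H]_4.
Implicit Types (r : R) (X Y : JC R) (A B : M).

Lemma herm4D (t1 t2 t3 : R) (a1 a2 a3 m1 m2 m3 : H) (t1' t2' t3' : R)
    (a1' a2' a3' m1' m2' m3' : H) :
  herm4 t1 t2 t3 a1 a2 a3 m1 m2 m3 +
    herm4 t1' t2' t3' a1' a2' a3' m1' m2' m3' =
  herm4 (t1 + t1') (t2 + t2') (t3 + t3') (a1 + a1') (a2 + a2') (a3 + a3')
    (m1 + m1') (m2 + m2') (m3 + m3').
Proof.
apply/matrixP; apply: ord4_ind; apply: ord4_ind; rewrite !mxE //=;
  by [rewrite quat_conjD | apply: quatP; rewrite /= ?addr0 //; field].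
Qed.

Lemma herm4Z r (t1 t2 t3 : R) (a1 a2 a3 m1 m2 m3 : H) :
  qreal r *: herm4 t1 t2 t3 a1 a2 a3 m1 m2 m3 =
  herm4 (r * t1) (r * t2) (r * t3) (qreal r * a1) (qreal r * a2) (qreal r * a3)
    (qreal r * m1) (qreal r * m2) (qreal r * m3).
Proof.
apply/matrixP; apply: ord4_ind; apply: ord4_ind; rewrite !mxE //=;
  by [rewrite quat_conjM qreal_conj qrealC | apply: quatP; rewrite /=; field].
Qed.

Lemma rtr_herm4 (t1 t2 t3 : R) (a1 a2 a3 m1 m2 m3 : H) :
  rtr (herm4 t1 t2 t3 a1 a2 a3 m1 m2 m3) = 0.
Proof. by rewrite /rtr sum_ord4 !mxE /=; field. Qed.

Lemma to_hermD X Y : to_herm (X + Y) = to_herm X + to_herm Y.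
Proof.
have e i j (P Q : J R) : (P + Q) i j = P i j + Q i j by rewrite mxE.
rewrite /to_herm herm4D.
rewrite -[cre (X + Y)]/(cre X + cre Y) -[cim (X + Y)]/(cim X + cim Y) !e.
by [].
Qed.

Lemma to_hermZ r X : to_herm (r%:C *: X) = qreal r *: to_herm X.
Proof.
have qE x : qreal r * x = r *: x by apply: quatP => /=; ring.
have reZ : cre (r%:C *: X) = r *: cre X.
  by rewrite /= scale0r subr0.
have imZ : cim (r%:C *: X) = r *: cim X.
  by rewrite /= scale0r addr0.
by rewrite /to_herm reZ imZ herm4Z !qE !mxE.
Qed.

Lemma to_herm_herm X : qherm (to_herm X).
Proof. exact: herm4_qherm. Qed.

Lemma rtr_to_herm X : rtr (to_herm X) = 0.
Proof. exact: rtr_herm4. Qed.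

Lemma herm3Z r (a b c : R) x y z :
  r *: herm3 a b c x y z =
  herm3 (r * a) (r * b) (r * c) (r *: x) (r *: y) (r *: z).
Proof.
apply/val_inj/matrixP; apply: ord3_ind; apply: ord3_ind; rewrite !mxE //=;
  by [rewrite ?cay_conjZ | apply: cayP; apply: quatP; rewrite /= ?mulr0].
Qed.

Lemma of_hermD A B : of_herm (A + B) = of_herm A + of_herm B.
Proof.
rewrite /of_herm /real_point !mxE; apply/esym.
have e (P Q P' Q' : J R) :
    Cplx P Q + Cplx P' Q' = Cplx (P + P') (Q + Q') :> JC R.
  by [].
rewrite e !herm3D; congr Cplx; congr herm3;
  try (by apply: cayP; rewrite /= ?addr0);
  by rewrite /= ?addr0 //; field.
Qed.

Lemma of_hermZ r A : of_herm (qreal r *: A) = r%:C *: of_herm A.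
Proof.
rewrite /of_herm /real_point !mxE; apply/esym.
have e (P Q : J R) : r%:C *: Cplx P Q = Cplx (r *: P) (r *: Q) :> JC R.
  by congr Cplx; rewrite /= scale0r ?subr0 ?addr0.
have qE x : qreal r * x = r *: x by apply: quatP => /=; ring.
rewrite e !herm3Z !qE; congr Cplx; congr herm3; rewrite ?mulr0 //;
  try (by apply: cayP; rewrite /= ?scaler0); by rewrite /=; field.
Qed.

Lemma of_herm_herm4 (t1 t2 t3 : R) (a1 a2 a3 m1 m2 m3 : H) :
  of_herm (herm4 t1 t2 t3 a1 a2 a3 m1 m2 m3) =
  real_point t1 t2 t3 a1 a2 a3 m1 m2 m3.
Proof.
rewrite /of_herm !mxE /=; congr real_point; by field.
Qed.

Definition taugamma X : JC R := jctau (jcgamma X).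

Lemma jgamma_herm3 (a b c : R) x y z :
  jgamma (herm3 a b c x y z) =
  herm3 a b c (cay_gamma x) (cay_gamma y) (cay_gamma z).
Proof.
apply/val_inj/matrixP; apply: ord3_ind; apply: ord3_ind; rewrite !mxE //=;
  by apply: cayP; rewrite /= ?oppr0.
Qed.

Lemma taugamma_of_herm B : taugamma (of_herm B) = of_herm B.
Proof.
rewrite /taugamma /jctau /cplx_tau /jcgamma /cplx_map /of_herm /real_point /=.
rewrite !jgamma_herm3 herm3N; congr Cplx; congr herm3; rewrite ?oppr0 //;
  by apply: cayP; rewrite /= ?opprK ?oppr0.
Qed.

(** The decomposition J^C = V + iV. *)
Lemma herm_split X :
  X = of_herm (to_herm X) + ii R *: of_herm (to_herm (- ii R *: X)).
Proof.
have niE : - ii R *: X = Cplx (cim X) (- cre X) :> JC R.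
  by rewrite scaleNr ii_scale; congr Cplx; rewrite /= ?opprK.
rewrite niE ii_scale; case: X {niE} => P Q; rewrite (herm3E P) (herm3E Q).
rewrite herm3N /to_herm !of_herm_herm4 !mxE /=.
have e (U V U' V' : J R) :
    Cplx U V + Cplx U' V' = Cplx (U + U') (V + V') :> JC R.
  by [].
rewrite /real_point e /= !herm3D; congr Cplx; congr herm3;
  rewrite ?oppr0 ?addr0 ?add0r //;
  by apply: cayP; rewrite /= ?opprK ?oppr0 ?addr0 ?add0r.
Qed.

Lemma to_herm_ii_of_herm B : to_herm (ii R *: of_herm B) = 0.
Proof.
rewrite ii_scale /of_herm /real_point /to_herm herm3N !mxE /= !oppr0.
by apply/matrixP; apply: ord4_ind; apply: ord4_ind;
  rewrite !mxE /=; apply: quatP; rewrite /=; field.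
Qed.

Lemma taugamma_imaginary X Y :
  taugamma (X + ii R *: Y) = taugamma X - ii R *: taugamma Y.
Proof.
have gD (P Q : J R) : jgamma (P + Q) = jgamma P + jgamma Q.
  apply/val_inj/matrixP=> i j; rewrite !mxE.
  by apply: cayP; rewrite /= ?opprD.
have gN (P : J R) : jgamma (- P) = - jgamma P.
  by apply/val_inj/matrixP=> i j; rewrite !mxE.
rewrite !ii_scale /taugamma /jctau /cplx_tau /jcgamma /cplx_map.
by congr Cplx; rewrite /= gD ?gN ?opprK // opprD.
Qed.

Lemma of_herm_fixed X : taugamma X = X -> of_herm (to_herm X) = X.
Proof.
rewrite {1 2 4}(herm_split X); set Y := of_herm _; set Z := of_herm _.
rewrite taugamma_imaginary !taugamma_of_herm => /addrI.
have -> : - (ii R *: Z) = Cplx (cim Z) (- cre Z) :> JC R.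
  by rewrite ii_scale; congr Cplx; rewrite /= opprK.
rewrite ii_scale => E.
have h1 : cim Z = - cim Z by exact: (congr1 (@cre R (J R)) E).
have h2 : cre Z = - cre Z by apply/esym; exact: (congr1 (@cim R (J R)) E).
have dbl (P : J R) : P = - P -> P = 0.
  move=> PN; have : (2 : R) *: P = 0 by rewrite scaler_nat mulr2n {2}PN subrr.
  by move=> /eqP; rewrite scaler_eq0 pnatr_eq0 /= => /eqP.
have -> : cre Z = 0 by exact: dbl h2.
have -> : cim Z = 0 by exact: dbl h1.
by rewrite oppr0 [Cplx 0 0](_ : _ = 0) // addr0.
Qed.

Lemma jcdet_of_herm B :
  jcdet (of_herm B) = (3^-1 * rtr3 (to_herm (of_herm B)))%:C.
Proof. by rewrite /of_herm jcdet_real_point to_herm_real_point. Qed.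

Lemma jcherm_of_herm A B : jcherm (of_herm A) (of_herm B) =
  (rtr (to_herm (of_herm A) *m to_herm (of_herm B)))%:C.
Proof. by rewrite /of_herm jcherm_real_point !to_herm_real_point. Qed.

End RealForm.

(** * The action of the unitary group *)

Section QuaternionicScalars.
Variables (R : realType) (m : nat).
Local Notation M := 'M[quat R]_m.+2.

(** Commuting with the diagonal idempotents makes A diagonal; commuting with
  the off-diagonal elements makes its entries equal and central. *)
Lemma commute_herm_scalar (A : M) :
  (forall B, qherm B -> A *m B = B *m A) -> exists r, A = qreal r *: 1%:M.
Proof.
move=> AC; pose o1 : 'I_m.+2 := Ordinal (isT : 1 < m.+2)%N.
have A_off i j : i != j -> A i j = 0.
  move=> ij; have /matrixP/(_ i j) := AC _ (@unit_idem_herm R m.+2 j).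
  by rewrite mulmx_elE el_mulmxE eqxx (negPf ij) mulr1.
have A_diag i j x : i != j -> A i i * x = x * A j j.
  move=> ij; have /matrixP/(_ i j) := AC _ (peirce_herm i j x).
  have e (U V : M) : (U + V) i j = U i j + V i j by rewrite mxE.
  rewrite /peirce mulmxDl mulmxDr !e !mulmx_elE !el_mulmxE.
  by rewrite !eqxx [j == i]eq_sym (negPf ij) !mulr1n !mulr0n !addr0.
have A_const i : A i i = A ord0 ord0.
  case: (eqVneq i ord0) => [->//|i0].
  by have := A_diag i ord0 1 i0; rewrite mulr1 mul1r.
have o10 : ord0 != o1 by [].
exists (q0 (A ord0 ord0)); rewrite -quat_central; last first.
  by move=> y; rewrite (A_diag _ o1) // A_const.
apply/matrixP=> i j; rewrite !mxE; case: (eqVneq i j) => [->|ij].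
  by rewrite mulr1 A_const.
by rewrite mulr0 A_off.
Qed.

End QuaternionicScalars.

Section Shift.
Variables (R : realType) (n : nat).
Local Notation M := 'M[quat R]_n.
Implicit Types (X S : M) (c : R).

Lemma mul_shift X S c :
  X *m (S + qreal c *: 1%:M) = X *m S + qreal c *: X.
Proof. by rewrite mulmxDr mulmx_realr mulmx1. Qed.

Lemma rtr2_shift S c :
  rtr2 (S + qreal c *: 1%:M) = rtr2 S + 2 * c * rtr S + c ^+ 2 * n%:R.
Proof.
rewrite /rtr2 mul_shift rtrD rtrZ rtrC mul_shift !rtrD !rtrZ rtr1.
by move: (rtr (S *m S)) (rtr S) (n%:R) => a b d; ring.
Qed.

Lemma rtr3_shift S c :
  rtr3 (S + qreal c *: 1%:M) =
  rtr3 S + 3 * c * rtr2 S + 3 * c ^+ 2 * rtr S + c ^+ 3 * n%:R.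
Proof.
have h2 := rtr2_shift S c; rewrite {1}/rtr2 in h2.
rewrite /rtr3 mul_shift rtrD rtrZ h2 rtrC mulmxA mul_shift.
rewrite [S *m (S + _)]mul_shift.
rewrite mulmxDl -scalemxAl !rtrD !rtrZ rtrD rtrZ.
rewrite /rtr2.
by move: (rtr (S *m S *m S)) (rtr (S *m S)) (rtr S) (n%:R) => a b d e; ring.
Qed.

End Shift.

Section Action.
Variable R : realType.
Local Notation H := (quat R).
Local Notation M := 'M[H]_4.
Local Notation ii := (ii R).
Implicit Types (r : R) (X Y : JC R) (A B : M).

Definition im_herm X : M := to_herm (- ii *: X).
Definition congr_mx A B : M := A *m B *m quat_adjmx A.
(** The complex linear extension to J^C = V + iV of the congruence by A on
  V. *)
Definition herm_act A X : JC R :=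
  of_herm (congr_mx A (to_herm X)) + ii *: of_herm (congr_mx A (im_herm X)).

Lemma to_hermN X : to_herm (- X) = - to_herm X.
Proof. exact: (additive_opp (@to_hermD R)). Qed.

Lemma ii_ii X : ii *: (ii *: X) = - X.
Proof. by rewrite scalerA ii_sq scaleN1r. Qed.

Lemma to_herm_ii X : to_herm (ii *: X) = - im_herm X.
Proof. by rewrite /im_herm scaleNr to_hermN opprK. Qed.

Lemma im_herm_ii X : im_herm (ii *: X) = to_herm X.
Proof. by rewrite /im_herm scaleNr ii_ii opprK. Qed.

Lemma im_hermD X Y : im_herm (X + Y) = im_herm X + im_herm Y.
Proof. by rewrite /im_herm scalerDr to_hermD. Qed.

Lemma im_herm_of_herm B : im_herm (of_herm B) = 0.
Proof. by rewrite /im_herm scaleNr to_hermN to_herm_ii_of_herm oppr0. Qed.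

Lemma herm_ext X Y : to_herm X = to_herm Y -> im_herm X = im_herm Y -> X = Y.
Proof.
by move=> h1 h2; rewrite (herm_split X) (herm_split Y) -!/(im_herm _) h1 h2.
Qed.

Lemma to_herm_of_herm0 B : qherm B -> rtr B = 0 -> to_herm (of_herm B) = B.
Proof.
by move=> hB tB; rewrite to_herm_of_herm // tB mul0r scale0r subr0.
Qed.

Lemma rtr_congr A B : quat_adjmx A *m A = 1%:M -> rtr (congr_mx A B) = rtr B.
Proof. by move=> AA; rewrite rtrC mulmxA AA mul1mx. Qed.

Lemma congr_mxM A B C : quat_adjmx A *m A = 1%:M ->
  congr_mx A B *m congr_mx A C = congr_mx A (B *m C).
Proof.
by move=> AA; rewrite /congr_mx !mulmxA -[_ *m _ *m A]mulmxA AA mulmx1.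
Qed.

Lemma congr_mxD A B C : congr_mx A (B + C) = congr_mx A B + congr_mx A C.
Proof. by rewrite /congr_mx mulmxDr mulmxDl. Qed.

Lemma congr_mxZ A r B : congr_mx A (qreal r *: B) = qreal r *: congr_mx A B.
Proof. by rewrite /congr_mx mulmx_realr -scalemxAl. Qed.

Lemma to_herm_pair A B : qherm A -> rtr A = 0 ->
  to_herm (of_herm A + ii *: of_herm B) = A.
Proof.
move=> hA tA; rewrite to_hermD to_herm_ii_of_herm addr0.
exact: to_herm_of_herm0.
Qed.

Lemma im_herm_pair A B : qherm B -> rtr B = 0 ->
  im_herm (of_herm A + ii *: of_herm B) = B.
Proof.
move=> hB tB; rewrite im_hermD im_herm_of_herm im_herm_ii add0r.
exact: to_herm_of_herm0.
Qed.

Lemma of_hermN B : of_herm (- B) = - of_herm B.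
Proof. exact: (additive_opp (@of_hermD R)). Qed.

Lemma taugamma_split X :
  taugamma X = of_herm (to_herm X) + ii *: of_herm (- im_herm X).
Proof.
rewrite {1}(herm_split X) -/(im_herm X) taugamma_imaginary !taugamma_of_herm.
by rewrite of_hermN scalerN.
Qed.

Lemma to_herm_taugamma X : to_herm (taugamma X) = to_herm X.
Proof.
rewrite taugamma_split; apply: to_herm_pair; last exact: rtr_to_herm.
exact: to_herm_herm.
Qed.

Lemma im_herm_taugamma X : im_herm (taugamma X) = - im_herm X.
Proof.
rewrite taugamma_split; apply: im_herm_pair.
  by apply/qhermN/to_herm_herm.
by rewrite rtrN rtr_to_herm oppr0.
Qed.

Lemma to_herm_congr A B : quat_adjmx A *m A = 1%:M -> qherm B -> rtr B = 0 ->
  to_herm (of_herm (congr_mx A B)) = congr_mx A B.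
Proof.
move=> AA hB tB; apply: to_herm_of_herm0; first exact: qherm_congr.
by rewrite rtr_congr.
Qed.

Section Unitary.
Variable A : M.
Hypothesis AA : quat_adjmx A *m A = 1%:M.

Lemma to_herm_act X : to_herm (herm_act A X) = congr_mx A (to_herm X).
Proof.
apply: to_herm_pair; first by apply/qherm_congr/to_herm_herm.
by rewrite rtr_congr // rtr_to_herm.
Qed.

Lemma im_herm_act X : im_herm (herm_act A X) = congr_mx A (im_herm X).
Proof.
apply: im_herm_pair; first by apply/qherm_congr/to_herm_herm.
by rewrite rtr_congr // rtr_to_herm.
Qed.

Lemma complex_scale (c : R[i]) X : c *: X =
  (complex.Re c)%:C *: X + ii *: ((complex.Im c)%:C *: X).
Proof.
rewrite scalerA -scalerDl; congr (_ *: _); case: c => a b.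
by rewrite /ii; apply: complex_eq => /=; ring.
Qed.

Lemma to_herm_scale (c : R[i]) X : to_herm (c *: X) =
  qreal (complex.Re c) *: to_herm X - qreal (complex.Im c) *: im_herm X.
Proof.
rewrite complex_scale to_hermD to_hermZ to_herm_ii /im_herm; congr (_ - _).
by rewrite -to_hermZ !scalerA mulrC.
Qed.

Lemma im_herm_scale (c : R[i]) X : im_herm (c *: X) =
  qreal (complex.Re c) *: im_herm X + qreal (complex.Im c) *: to_herm X.
Proof.
rewrite complex_scale im_hermD im_herm_ii to_hermZ; congr (_ + _).
by rewrite /im_herm -to_hermZ !scalerA mulrC.
Qed.

Lemma congr_mxN B : congr_mx A (- B) = - congr_mx A B.
Proof. by rewrite /congr_mx mulmxN mulNmx. Qed.

Lemma herm_act_linear : linear (herm_act A).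
Proof.
move=> c X Y.
have := (to_herm_act X, to_herm_act Y, to_herm_act (c *: X + Y)).
have := (im_herm_act X, im_herm_act Y, im_herm_act (c *: X + Y)).
move: (herm_act A X) (herm_act A Y) (herm_act A (c *: X + Y)) => U V W.
move=> [[imU imV] imW] [[reU reV] reW]; apply: herm_ext.
  rewrite to_hermD to_herm_scale reU imU reV reW to_hermD to_herm_scale.
  by rewrite !congr_mxD congr_mxN !congr_mxZ.
rewrite im_hermD im_herm_scale imU reU imV imW im_hermD im_herm_scale.
by rewrite !congr_mxD !congr_mxZ.
Qed.

Lemma taugamma_act X : taugamma (herm_act A X) = herm_act A (taugamma X).
Proof.
have [reX imX] := (to_herm_act X, im_herm_act X).
have [reY imY] := (to_herm_act (taugamma X), im_herm_act (taugamma X)).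
rewrite to_herm_taugamma in reY; rewrite im_herm_taugamma congr_mxN in imY.
move: (herm_act A X) (herm_act A (taugamma X)) reX imX reY imY => U V.
move=> reU imU reV imV; apply: herm_ext.
  by rewrite to_herm_taugamma reU reV.
by rewrite im_herm_taugamma imU imV.
Qed.

End Unitary.
End Action.

Section Invariance.
Variable R : realType.
Local Notation H := (quat R).
Local Notation M := 'M[H]_4.
Local Notation ii := (ii R).
Implicit Types (r : R) (X Y : JC R) (A B : M).

Section Unitary.
Variable A : M.
Hypothesis AA : quat_adjmx A *m A = 1%:M.

Lemma jcdet_congr B : qherm B -> rtr B = 0 ->
  jcdet (of_herm (congr_mx A B)) = jcdet (of_herm B).
Proof.
move=> hB tB; rewrite !jcdet_of_herm to_herm_congr // to_herm_of_herm0 //.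
by rewrite /rtr3 !congr_mxM // rtr_congr.
Qed.

Lemma jcherm_congr B C : qherm B -> rtr B = 0 -> qherm C -> rtr C = 0 ->
  jcherm (of_herm (congr_mx A B)) (of_herm (congr_mx A C)) =
  jcherm (of_herm B) (of_herm C).
Proof.
move=> hB tB hC tC; rewrite !jcherm_of_herm !to_herm_congr //.
by rewrite !to_herm_of_herm0 // congr_mxM // rtr_congr.
Qed.

Lemma jcdet_act X : jcdet (herm_act A X) = jcdet X.
Proof.
rewrite {2}(herm_split X) -/(im_herm X) /herm_act !jcdet_imaginary.
have [h1 h2] := (to_herm_herm X, to_herm_herm (- ii *: X)).
have [t1 t2] := (rtr_to_herm X, rtr_to_herm (- ii *: X)).
rewrite -/(im_herm X) in h2 t2; move: h1 h2 t1 t2.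
move: (to_herm X) (im_herm X) => S T hS hT tS tT.
have := jcdet_congr (qhermB hS hT).
rewrite rtrB tS tT subrr congr_mxD congr_mxN !of_hermD !of_hermN.
move=> /(_ erefl) minus; have := jcdet_congr (qhermD hS hT).
rewrite rtrD tS tT addr0 congr_mxD !of_hermD => /(_ erefl) plus.
by rewrite plus minus (jcdet_congr hS tS) (jcdet_congr hT tT).
Qed.

Lemma jcherm_act X Y : jcherm (herm_act A X) (herm_act A Y) = jcherm X Y.
Proof.
rewrite {2}(herm_split X) {2}(herm_split Y) -/(im_herm X) -/(im_herm Y).
rewrite /herm_act !jcherm_imaginary.
have [hX hX' tX tX'] := And4 (to_herm_herm X) (to_herm_herm (- ii *: X))
  (rtr_to_herm X) (rtr_to_herm (- ii *: X)).
have [hY hY' tY tY'] := And4 (to_herm_herm Y) (to_herm_herm (- ii *: Y))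
  (rtr_to_herm Y) (rtr_to_herm (- ii *: Y)).
rewrite -!/(im_herm _) in hX' hY' tX' tY'; move: hX hX' tX tX' hY hY' tY tY'.
move: (to_herm X) (im_herm X) (to_herm Y) (im_herm Y) => S S' T T'.
move=> hS hS' tS tS' hT hT' tT tT'.
rewrite (jcherm_congr hS tS hT tT) (jcherm_congr hS' tS' hT' tT').
by rewrite (jcherm_congr hS tS hT' tT') (jcherm_congr hS' tS' hT tT).
Qed.

End Unitary.

Lemma herm_actM A B X : quat_adjmx A *m A = 1%:M -> quat_adjmx B *m B = 1%:M ->
  herm_act (A *m B) X = herm_act A (herm_act B X).
Proof.
move=> AA BB; have AB : quat_adjmx (A *m B) *m (A *m B) = 1%:M.
  by rewrite quat_adjmxM mulmxA -[_ *m _ *m A]mulmxA AA mulmx1.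
have cM C : congr_mx (A *m B) C = congr_mx A (congr_mx B C).
  by rewrite /congr_mx quat_adjmxM !mulmxA.
by apply: herm_ext; rewrite ?(to_herm_act, im_herm_act) // cM.
Qed.

Lemma herm_act1 X : herm_act 1%:M X = X.
Proof.
have c1 C : congr_mx (1%:M : M) C = C.
  by rewrite /congr_mx quat_adjmx1 mul1mx mulmx1.
by rewrite /herm_act !c1 [RHS]herm_split.
Qed.

Lemma jcdet_fixed X : taugamma X = X -> jcdet X = (3^-1 * rtr3 (to_herm X))%:C.
Proof.
move=> fX; rewrite -{1}(of_herm_fixed fX) jcdet_of_herm.
by rewrite (of_herm_fixed fX).
Qed.

Lemma jcherm_fixed X : taugamma X = X -> jcherm X X = (rtr2 (to_herm X))%:C.
Proof.
move=> fX; rewrite -{1 2}(of_herm_fixed fX) jcherm_of_herm.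
by rewrite (of_herm_fixed fX).
Qed.

Lemma of_herm1 : of_herm (1%:M : M) = 0.
Proof.
rewrite -[LHS](of_herm_fixed (taugamma_of_herm _)) (to_herm_of_herm (qherm1 _ _)).
rewrite rtr1 divff ?pnatr_eq0 // qreal1 scale1r subrr.
by apply: (addrI (of_herm 0)); rewrite -of_hermD !addr0.
Qed.

(** Since f commutes with tau gamma it acts on V, that is on traceless
  Hermitian matrices.  Its extension [lift f] to all Hermitian matrices fixes
  the unit matrix, and [rtr2_shift] and [rtr3_shift] show that it preserves the
  traces of squares and cubes.  So it is inner, and f is determined by its
  restriction to V. *)
Theorem e6_taugamma_inner (f g : JC R -> JC R) :
    linear f -> cancel g f ->
    (forall X, jcdet (f X) = jcdet X) ->
    (forall X Y, jcherm (f X) (f Y) = jcherm X Y) ->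
    (forall X, taugamma (f X) = f (taugamma X)) ->
    (forall X, taugamma (g X) = g (taugamma X)) ->
  exists2 A : M, quat_adjmx A *m A = 1%:M & forall X, f X = herm_act A X.
Proof.
move=> flin gK fdet fherm ftau gtau.
have fD X Y : f (X + Y) = f X + f Y.
  by have := flin 1 X Y; rewrite !scale1r.
have f0 : f 0 = 0 by apply: (addrI (f 0)); rewrite -fD !addr0.
have fZ c X : f (c *: X) = c *: f X.
  by have := flin c X 0; rewrite f0 !addr0.
pose lift h B : M := to_herm (h (of_herm B)) + qreal (rtr B / 4) *: 1%:M.
have lift_herm h B : qherm (lift h B).
  by apply: qhermD; [exact: to_herm_herm | apply: qhermZ; exact: qherm1].
have n4 : 4%:R != 0 :> R by rewrite pnatr_eq0.
have lift_tr h B : rtr (lift h B) = rtr B.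
  by rewrite rtrD rtr_to_herm add0r rtrZ rtr1 mulfVK.
have ffix B : taugamma (f (of_herm B)) = f (of_herm B).
  by rewrite ftau taugamma_of_herm.
have gfix B : taugamma (g (of_herm B)) = g (of_herm B).
  by rewrite gtau taugamma_of_herm.
have split_tr B : qherm B ->
    B = to_herm (of_herm B) + qreal (rtr B / 4) *: 1%:M.
  by move=> hB; rewrite to_herm_of_herm // subrK.
have inv_forms B : rtr2 (to_herm (f (of_herm B))) = rtr2 (to_herm (of_herm B)) /\
    rtr3 (to_herm (f (of_herm B))) = rtr3 (to_herm (of_herm B)).
  have three : (3^-1 : R) != 0 by rewrite invr_eq0 pnatr_eq0.
  have fixB := taugamma_of_herm B; split.
    have := fherm (of_herm B) (of_herm B).
    by rewrite (jcherm_fixed (ffix B)) (jcherm_fixed fixB) => -[].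
  have := fdet (of_herm B).
  by rewrite (jcdet_fixed (ffix B)) (jcdet_fixed fixB) => -[] /(mulfI three).
have liftJ : jordan_endo (lift f).
  apply: (@jordan_endo_of_traces R 4 (lift f) (lift g))
    => [B C|r B|B _|B _|B hB|B _|B hB|B hB] //.
  - rewrite /lift of_hermD fD to_hermD rtrD mulrDl addrACA -scalerDl.
    by congr (_ + _ *: _); apply: quatP => /=; rewrite ?addr0.
  - rewrite /lift of_hermZ fZ to_hermZ rtrZ scalerDr scalerA -qrealM.
    by rewrite mulrA.
  - rewrite {1}/lift lift_tr {1}/lift of_hermD of_hermZ of_herm1 scaler0 addr0.
    by rewrite of_herm_fixed // gK -split_tr.
  - rewrite [in RHS](split_tr _ hB) /lift !rtr2_shift !rtr_to_herm.
    by rewrite (inv_forms B).1.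
  - rewrite [in RHS](split_tr _ hB) /lift !rtr3_shift !rtr_to_herm.
    by rewrite (inv_forms B).1 (inv_forms B).2.
have [A AA liftE] := jordan_endo_inner liftJ.
exists A => // X; rewrite {1}(herm_split X) fD fZ -/(im_herm X) /herm_act.
have fE B : qherm B -> rtr B = 0 -> f (of_herm B) = of_herm (congr_mx A B).
  move=> hB tB; rewrite /congr_mx -liftE // /lift tB mul0r scale0r addr0.
  by rewrite of_herm_fixed.
by rewrite !fE //; do ?[exact: to_herm_herm | exact: rtr_to_herm].
Qed.

End Invariance.

(** * The homomorphism from Sp(4) *)

Lemma first_isomorphism (G K : groupType) (N : normalSubgroup G)
    (phi : G -> K) :
    {morph phi : x y / (x * y)%g} -> (forall k, exists x, phi x = k) ->
    (forall x, phi x = 1%g <-> x \in (N : {pred G})) ->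
  group_isomorphic K (quotient_group N).
Proof.
move=> phiM phi_onto phi_ker.
have phi1 : phi 1%g = 1%g.
  by apply: (mulgI (phi 1%g)); rewrite -phiM !mulg1.
have phiV x : phi x^-1%g = (phi x)^-1%g.
  by apply: (mulgI (phi x)); rewrite -phiM !mulgV phi1.
have fiber x y : phi x = phi y ->
    \pi_(quotient_group N)%qT x = \pi_(quotient_group N)%qT y.
  by move=> xy; apply/quotient_groupP/phi_ker; rewrite phiM phiV xy mulVg.
have coset x y :
    \pi_(quotient_group N)%qT x = \pi_(quotient_group N)%qT y -> phi x = phi y.
  move=> /quotient_groupP/phi_ker; rewrite phiM phiV => xy.
  by rewrite -[LHS]mulg1 -xy mulgA mulgV mul1g.
pose pre k := sval (cid (phi_onto k)).
have preK k : phi (pre k) = k by rewrite /pre; case: cid.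
exists (fun k => \pi_(quotient_group N)%qT (pre k)); split.
  exists (fun q => phi (repr q)) => [k|q].
    by rewrite -[RHS]preK; apply: coset; rewrite reprK.
  by rewrite -[RHS]reprK; apply: fiber; rewrite preK.
move=> k l; rewrite -[RHS]/(quotient_mul _ _) -pi_quotient_mul.
by apply: fiber; rewrite phiM !preK.
Qed.

Section Representation.
Variable R : realType.
Local Notation H := (quat R).
Local Notation M := 'M[H]_4.
Implicit Types (X : JC R).

Definition Sp4_act_fun (A : Sp4 R) : JC R -> JC R := herm_act (A : M).

Lemma Sp4_unitary (A : Sp4 R) : quat_adjmx A *m A = 1%:M.
Proof. by apply/eqP; exact: Sp4P A. Qed.

Lemma Sp4_act_cancel (A : Sp4 R) : cancel (Sp4_act_fun A) (Sp4_act_fun A^-1%g).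
Proof.
have AVA : (A^-1%g : M) *m (A : M) = 1%:M by exact: Sp4_unitary.
move=> X; have := herm_actM X (Sp4_unitary A^-1%g) (Sp4_unitary A).
by rewrite AVA herm_act1 => /esym.
Qed.

Fact Sp4_act_linaut (A : Sp4 R) :
  `[< linear (Sp4_act_fun A) /\ bijective (Sp4_act_fun A) >].
Proof.
apply/asboolP; split; first exact: herm_act_linear (Sp4_unitary A).
exists (Sp4_act_fun A^-1%g); first exact: Sp4_act_cancel.
by have := @Sp4_act_cancel A^-1%g; rewrite invgK.
Qed.

Fact Sp4_act_isE6 (A : Sp4 R) : LinAut (Sp4_act_linaut A) \in @isE6 R.
Proof.
apply/asboolP; split=> [X|X Y]; first exact: jcdet_act (Sp4_unitary A) X.
exact: jcherm_act (Sp4_unitary A) X Y.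
Qed.

Fact Sp4_act_commutes (A : Sp4 R) :
  MkE6 (Sp4_act_isE6 A) \in @commutes_taugamma R.
Proof. by apply/asboolP => X; exact: taugamma_act (Sp4_unitary A) X. Qed.

Definition Sp4_act (A : Sp4 R) : E6_taugamma R :=
  MkE6_taugamma (Sp4_act_commutes A).

Lemma Sp4_actE (A : Sp4 R) X : Sp4_act A X = herm_act (A : M) X.
Proof. by []. Qed.

Lemma E6_taugamma_ext (f g : E6_taugamma R) : (forall X, f X = g X) -> f = g.
Proof. by move=> fg; do 2!apply/val_inj; apply: linaut_ext. Qed.

Lemma Sp4_actM : {morph Sp4_act : x y / (x * y)%g}.
Proof.
by move=> A B; apply: E6_taugamma_ext => X;
  rewrite Sp4_actE herm_actM ?Sp4_unitary.
Qed.

Lemma Sp4_act_onto f : exists A, Sp4_act A = f.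
Proof.
have /asboolP[fdet fherm] := E6P f.
have /asboolP ftau := E6_taugammaP f.
have /asboolP gtau := E6_taugammaP (f^-1)%g.
have gK : cancel (f^-1%g : E6_taugamma R) f.
  by move=> X; rewrite -[LHS]/((f * f^-1)%g X) mulgV.
have flin := @linaut_linear _ _ f.
have [A AA fA] := e6_taugamma_inner flin gK fdet fherm ftau gtau.
have hA : A \in @isSp4 R by apply/eqP.
by exists (MkSp4 hA); apply: E6_taugamma_ext => X; rewrite Sp4_actE fA.
Qed.

(** An A in the kernel fixes all traceless Hermitian matrices under congruence,
  and the unit matrix because it is unitary, so it is a real scalar. *)
Lemma Sp4_act_ker (A : Sp4 R) : Sp4_act A = 1%g <-> A \in (Z2 R : {pred Sp4 R}).
Proof.
have AA := Sp4_unitary A; split=> [PA|].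
  have AC B : qherm B -> (A : M) *m B = B *m A.
    move=> hB; have AA' := quat_mulmx1C AA.
    suff : congr_mx A B = B.
      by move=> {2}<-; rewrite /congr_mx -!mulmxA AA mulmx1.
    have tr0 C : qherm C -> rtr C = 0 -> congr_mx A C = C.
      move=> hC tC.
      have := congr1 (fun h : E6_taugamma R => to_herm (h (of_herm C))) PA.
      by rewrite Sp4_actE to_herm_act // to_herm_of_herm0.
    rewrite -(subrK (qreal (rtr B / 4) *: 1%:M) B) -to_herm_of_herm //.
    rewrite congr_mxD congr_mxZ tr0 ?rtr_to_herm //; last exact: to_herm_herm.
    by rewrite /congr_mx mulmx1 AA'.
  have [r Ar] := commute_herm_scalar AC.
  have r2 : r * r = 1.
    have /matrixP/(_ ord0 ord0) := AA.
    rewrite Ar quat_adjmx_real quat_adjmx1 mulmx_realr mulmx1 scalerA -qrealM.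
    by rewrite !mxE mulr1 => -[].
  have : (r - 1) * (r + 1) == 0 by rewrite -subr_sqr_1 expr2 r2 subrr.
  rewrite mulf_eq0 subr_eq0 addr_eq0 unfold_in /isZ2 Ar.
  case/orP => /eqP ->; first by rewrite qreal1 scale1r eqxx.
  have -> : qreal (-1) = -1 :> H by apply: quatP; rewrite /= ?oppr0.
  by rewrite scaleN1r eqxx orbT.
rewrite unfold_in => hA; apply: E6_taugamma_ext => X; rewrite Sp4_actE.
have cA C : congr_mx A C = C.
  rewrite /congr_mx; case/orP: hA => /eqP ->.
    by rewrite quat_adjmx1 mul1mx mulmx1.
  by rewrite quat_adjmxN quat_adjmx1 mulmxN !mulNmx opprK mul1mx mulmx1.
by rewrite /herm_act !cA -herm_split.
Qed.

End Representation.

Theorem theorem3p12p2 (R : realType) :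
  group_isomorphic (E6_taugamma R) (quotient_group (Z2 R)).
Proof.
exact: first_isomorphism (@Sp4_actM R) (@Sp4_act_onto R) (@Sp4_act_ker R).
Qed.
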